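(* Let $(X_1,Y_1),(X_2,Y_2),\dots$ be a random sample (i.i.d. copies) of a random vector $(X,Y)$ with continuous joint distribution function $H$, marginal distribution functions $F$ and $G$, and (unique) copula $A$. Assume that $A$ allows a continuous Markov kernel $K_A$ and define $K_H(x,(-\infty,y]):=K_A(F(x),[0,G(y)])$ for $x,y\in\mathbb{R}$. Let $F_n,G_n$ be the univariate empirical distribution functions and $E_n$ the empirical copula of $(X_1,Y_1),\dots,(X_n,Y_n)$, and set $N(n):=\lfloor n^s\rfloor$ for some $s\in(0,\tfrac12)$. Then, almost surely, $$\lim_{n\to\infty}\sup_{(x,y)\in\mathbb{R}^2}\left|K_{\mathcal{CB}_{N(n)}(E_n)}(F_n(x),[0,G_n(y)])-K_H(x,(-\infty,y])\right|=0.$$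
   Context: A (bivariate) copula is a distribution function on $[0,1]^2$ with uniform marginals; each copula $B$ corresponds to a doubly stochastic measure $\mu_B$ with $B(x,y)=\mu_B([0,x]\times[0,y])$. A Markov kernel of a copula $B$ is a map $K_B:[0,1]\times\mathcal{B}([0,1])\to[0,1]$ such that $x\mapsto K_B(x,E)$ is measurable for each Borel $E$, $E\mapsto K_B(x,E)$ is a probability measure for each $x$, and $\int_{E_1}K_B(x,E_2)\,d\lambda(x)=\mu_B(E_1\times E_2)$ for all Borel $E_1,E_2\subseteq[0,1]$ ($\lambda$ = Lebesgue measure). A copula $A$ allows a continuous Markov kernel if it has a version $K_A$ of its Markov kernel such that $(x,y)\mapsto K_A(x,[0,y])$ is continuous on $[0,1]^2$; $K_A$ denotes this version. Checkerboard approximation: for $N\in\mathbb{N}$ let $I_1^N=[0,\tfrac1N]$, $I_i^N=(\tfrac{i-1}N,\tfrac iN]$ for $i=2,\dots,N$, and $Q_{i,j}^N=I_i^N\times I_j^N$. For a copula $B$, $\mathcal{CB}_N(B)$ is the absolutely continuous copula with density $N^2\sum_{i,j=1}^N\mu_B(Q^N_{i,j})\mathbf 1_{Q^N_{i,j}}$, and its Markov kernel is taken to be the version $K_{\mathcal{CB}_N(B)}(x,[0,y])=N^2\sum_{i,j=1}^N\mu_B(Q^N_{i,j})\mathbf 1_{I^N_i}(x)\,\lambda([0,y]\cap I^N_j)$ for $(x,y)\in[0,1]^2$. Empirical copula: with $H_n$ the bivariate empirical distribution function of the first $n$ observations, almost surely there are no ties and there is a unique subcopula $E_n'$ on $\{0,\tfrac1n,\dots,1\}^2$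 with $H_n(x,y)=E_n'(F_n(x),G_n(y))$ for all $(x,y)$; $E_n$ is the copula extending $E_n'$ by bilinear interpolation on each square $[\tfrac{i-1}n,\tfrac in]\times[\tfrac{j-1}n,\tfrac jn]$. *)

(* Defs.v *)
From HB Require Import structures.
From mathcomp Require Import all_boot all_order all_algebra.
From mathcomp Require Import all_classical all_reals all_analysis.
From mathcomp Require Import measurable_realfun finmap.
Set Implicit Arguments. Unset Strict Implicit. Unset Printing Implicit Defensive.
Import Order.TTheory GRing.Theory Num.Theory.
Import numFieldNormedType.Exports.
Local Open Scope classical_set_scope.
Local Open Scope ring_scope.

Section Defs.
Context {R : realType}.

Definition unitI : set R := `[0, 1].

Definition copula_measure (A : R -> R -> R) (mu : probability (R * R)%type R)
  : Prop :=
  [/\ mu (unitI `*` unitI) = 1%E,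
      (forall x y, 0 <= x <= 1 -> 0 <= y <= 1 ->
         mu (`[0, x] `*` `[0, y]) = (A x y)%:E) &
      (forall x, 0 <= x <= 1 -> A x 1 = x /\ A 1 x = x)].

Definition is_copula (A : R -> R -> R) : Prop :=
  exists mu, copula_measure A mu.

(* K is (a version of) the Markov kernel of the copula A
   (only its values for x in [0,1] and on Borel subsets of [0,1] matter). *)
Definition is_markov_kernel (A : R -> R -> R)
  (K : R -> {measure set R -> \bar R}) : Prop :=
  [/\ (forall E : set R, measurable E -> E `<=` unitI ->
         measurable_fun unitI (fun x => K x E)),
      (forall x, 0 <= x <= 1 -> K x unitI = 1%E) &
      exists mu, copula_measure A mu /\
        forall E1 E2 : set R, measurable E1 -> E1 `<=` unitI ->
                      measurable E2 -> E2 `<=` unitI ->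
          (\int[lebesgue_measure]_(x in E1) K x E2)%E = mu (E1 `*` E2)].

Definition continuous_kernel (K : R -> {measure set R -> \bar R}) : Prop :=
  {within unitI `*` unitI,
     continuous (fun p : R * R => fine (K p.1 `[0, p.2]%classic))}.

(* I_{i+1}^N (indices shifted to start at 0): I_1 = [0,1/N],
   I_{i+1} = (i/N, (i+1)/N] for i >= 1. *)
Definition cb_int (N i : nat) : set R :=
  if i == 0%N then `[0, N%:R^-1]%classic else `]i%:R / N%:R, i.+1%:R / N%:R]%classic.

(* mu_B((a,b] x (c,d]) (closed at 0) expressed through the copula B. *)
Definition rect_mass (B : R -> R -> R) (a b c d : R) : R :=
  B b d - B a d - B b c + B a c.

Definition cb_mass (B : R -> R -> R) (N i j : nat) : R :=
  rect_mass B (i%:R / N%:R) (i.+1%:R / N%:R) (j%:R / N%:R) (j.+1%:R / N%:R).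

Definition cb_kernel (N : nat) (B : R -> R -> R) (x y : R) : R :=
  (N%:R ^+ 2) * \sum_(i < N) \sum_(j < N)
     cb_mass B N i j * \1_(cb_int N i) x
       * fine (lebesgue_measure (`[0, y] `&` cb_int N j)).

Definition emp_df (X : nat -> R) (n : nat) (x : R) : R :=
  n%:R^-1 * \sum_(k < n) (X k <= x)%R%:R.

Definition emp_joint_df (X Y : nat -> R) (n : nat) (x y : R) : R :=
  n%:R^-1 * \sum_(k < n) ((X k <= x) && (Y k <= y))%R%:R.

(* The subcopula E_n' on the grid {0,1/n,...,1}^2, given at (i/n, j/n):
   the value of H_n at any (x,y) with F_n(x) = i/n, G_n(y) = j/n
   (well defined when there are no ties, which holds almost surely). *)
Definition emp_subcopula (X Y : nat -> R) (n i j : nat) : R :=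
  let p := xget (0, 0) [set p : R * R | emp_df X n p.1 = i%:R / n%:R /\
                                        emp_df Y n p.2 = j%:R / n%:R] in
  emp_joint_df X Y n p.1 p.2.

(* cell index of u in [0,1] for the grid {0,1/n,...,1}:
   the i in {0,...,n-1} with u in [i/n, (i+1)/n] *)
Definition cell (n : nat) (u : R) : nat := minn (Num.truncn (n%:R * u)) n.-1.

(* The empirical copula E_n: bilinear interpolation of E_n'. *)
Definition emp_copula (X Y : nat -> R) (n : nat) (u v : R) : R :=
  let i := cell n u in let j := cell n v in
  let t := n%:R * u - i%:R in let r := n%:R * v - j%:R in
  (1 - t) * (1 - r) * emp_subcopula X Y n i j
  + t * (1 - r) * emp_subcopula X Y n i.+1 j
  + (1 - t) * r * emp_subcopula X Y n i j.+1
  + t * r * emp_subcopula X Y n i.+1 j.+1.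

Definition Nres (s : R) (n : nat) : nat := Num.truncn (n%:R `^ s).

End Defs.

Section Prob.
Context {R : realType} {d : measure_display} {Omega : measurableType d}.

Definition pairRV (X Y : nat -> Omega -> R) (i : nat) : Omega -> R * R :=
  fun w => (X i w, Y i w).

Definition iid_pairs (P : probability Omega R) (X Y : nat -> Omega -> R) : Prop :=
  (forall i, measurable_fun setT (X i)) /\ (forall i, measurable_fun setT (Y i)) /\
  (forall (I : {fset nat}) (B : nat -> set (R * R)%type),
     (forall i, measurable (B i)) ->
     P (\bigcap_(i in [set` I]) (pairRV X Y i @^-1` B i))
     = (\prod_(i <- I) P (pairRV X Y i @^-1` B i))%E) /\
  (forall i (B : set (R * R)%type), measurable B ->
     P (pairRV X Y i @^-1` B) = P (pairRV X Y 0 @^-1` B)).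

Definition joint_df (P : probability Omega R) (X Y : Omega -> R) (x y : R) : R :=
  fine (P [set w | X w <= x /\ Y w <= y]).
Definition marg_df (P : probability Omega R) (X : Omega -> R) (x : R) : R :=
  fine (P [set w | X w <= x]).

End Prob.

(* Main.v *)
(* With D(i, j) = B((i+1)/N, j/N) - B(i/N, j/N), the kernel of the checkerboard
   CB_N(B) at a point of the cell Q_(i,j) is N times (a convex combination of
   D(i, j) and D(i, j+1)) - D(i, 0): the masses telescope along the column, so
   a uniform error delta on B costs only O(N delta) on the kernel.  For B = A,
   N D(i, j) is the mean of K_A(., [0, j/N]) over the cell, hence close to K_A by
   uniform continuity.  It remains to see that N(n) sup |E_n - A| -> 0 a.s.
   Since A is 1-Lipschitz and, without ties, every level i/n is attained by F_n
   and G_n, sup |E_n - A| is controlled by sup |H_n - H|.  The latter is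
   O(n^-r) a.s. for each r < 1/2: a Chernoff bound at O(n^2) pairs of quantiles,
   monotonicity in between, and Borel-Cantelli; choose s < r < 1/2. *)
Require Import Defs.
From HB Require Import structures.
From mathcomp Require Import all_boot all_order all_algebra.
From mathcomp Require Import all_classical all_reals all_analysis.
From mathcomp Require Import measurable_realfun finmap.
From mathcomp Require Import ring lra zify.
Set Implicit Arguments. Unset Strict Implicit. Unset Printing Implicit Defensive.
Import Order.TTheory GRing.Theory Num.Theory.
Import numFieldNormedType.Exports.
Local Open Scope classical_set_scope.
Local Open Scope ring_scope.

(** * A Chernoff bound for counts of independent events *)

(** The delicate point is the rate. The checkerboard kernel multiplies every error by N(n), about
    n^s, so plain uniform convergence of H_n does not suffice: a power n^-r with r > s is required.
    At precision n^-r the Chernoff exponent is n^(1 - 2r) / 8, a positive power of n when r < 1/2,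
    and it then beats the (n+1)^2 pairs of quantiles; this is where s < 1/2 comes from. Thresholds
    range over the extended reals, +oo erasing a coordinate, so a single event controls H_n, F_n and
    G_n together. Continuity of H serves twice: it passes to the marginals, so that quantiles of
    every level in ]0, 1[ exist and cut the line into brackets of mass at most 2/n; and the same
    brackets squeeze the probability of a tie to 0. The empirical copula enters the kernel estimate
    only through its uniform distance to A. *)

Lemma expR_le_quadratic (R : realType) (t : R) : 0 <= t <= 2^-1 ->
  expR t <= 1 + t + 2 * t ^+ 2.
Proof.
move=> /andP[t0 t2].
have h : 1 - t <= expR (- t) by rewrite expR_ge1Dx.
have h1 : 0 < 1 - t by lra.
have -> : expR t = (expR (- t))^-1 by rewrite expRN invrK.
apply: (@le_trans _ _ (1 - t)^-1).
  by rewrite lef_pV2// posrE expR_gt0.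
rewrite -[leLHS]mul1r ler_pdivrMr//.
(* (1 - t)(1 + t + 2 t^2) = 1 + t^2 (1 - 2 t), which is at least 1 on [0, 1/2]. *)
have : 0 <= t ^+ 2 * (1 - 2 * t) by rewrite mulr_ge0 ?sqr_ge0//; lra.
by nra.
Qed.

Section chernoff.
Context {R : realType} {d : measure_display} {Omega : measurableType d}.
Variable P : probability Omega R.

Lemma finite_union_bound (I : finType) (E : set Omega) (F : I -> set Omega)
    (c : I -> R) :
  measurable E -> (forall i, measurable (F i)) ->
  (forall w, E w -> exists i, F i w) ->
  (forall i, (P (F i) <= (c i)%:E)%E) -> (P E <= (\sum_i c i)%:E)%E.
Proof.
move=> mE mF EF Fc.
have H s : (P (\big[setU/set0]_(i <- s) F i) <= (\sum_(i <- s) c i)%:E)%E.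
  elim: s => [|i s IH]; first by rewrite !big_nil measure0.
  rewrite !big_cons EFinD; apply: le_trans (leeD (Fc i) IH).
  by apply: measureU2 => //; exact: bigsetU_measurable.
apply: le_trans (H (index_enum I)).
apply: le_measure; [exact: mem_set| | ].
  by apply/mem_set/bigsetU_measurable => i _; exact: mF.
move=> w /EF [i Fi]; rewrite -bigcup_seq; exists i => //=.
exact: mem_index_enum.
Qed.

(** The signature [f] prescribes which events occur, and the 2^n atoms partition the space. The
    exponential moment of a count thus becomes a finite sum over [f], and independence a product
    formula for each atom. *)
Definition atom (n : nat) (E : nat -> set Omega) (f : {ffun 'I_n -> bool}) :=
  \bigcap_(k in [set: 'I_n]) (if f k then E k else ~` E k).

Lemma measurable_atom (n : nat) (E : nat -> set Omega) (f : {ffun 'I_n -> bool}) :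
  (forall k, measurable (E k)) -> measurable (atom E f).
Proof.
move=> mE; apply: fin_bigcap_measurable => // k _.
by case: (f k) => //; exact: measurableC.
Qed.

Lemma measurable_count (n : nat) (E : nat -> set Omega) :
  (forall k, measurable (E k)) ->
  measurable_fun setT (fun w => \sum_(k < n) \1_(E k) w : R).
Proof. by move=> mE; apply: measurable_sum => k; apply: measurable_indic. Qed.

Lemma measurable_count_ge (n : nat) (E : nat -> set Omega) (c : R) :
  (forall k, measurable (E k)) ->
  measurable [set w | c <= \sum_(k < n) \1_(E k) w].
Proof.
move=> mE; have := measurable_count n mE measurableT (measurable_itv `[c, +oo[).
rewrite setTI; congr measurable.
by apply/seteqP; split => w /=; rewrite in_itv/= andbT.
Qed.

Lemma measurable_count_le (n : nat) (E : nat -> set Omega) (c : R) :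
  (forall k, measurable (E k)) ->
  measurable [set w | \sum_(k < n) \1_(E k) w <= c].
Proof.
move=> mE; have := measurable_count n mE measurableT (measurable_itv `]-oo, c]).
by rewrite setTI; congr measurable; apply/seteqP; split => w /=; rewrite in_itv.
Qed.

Lemma chernoff (n : nat) (E : nat -> set Omega) (p e : R) :
  (forall k, measurable (E k)) -> 0 <= p <= 1 -> 0 <= e <= 1 ->
  (forall f : {ffun 'I_n -> bool},
    P (atom E f) = (\prod_(k < n) (if f k then p else 1 - p))%:E) ->
  (P [set w | (p + e) *+ n <= \sum_(k < n) \1_(E k) w]%R
    <= (expR (- (e ^+ 2 / 8 *+ n)))%:E)%E.
Proof.
move=> mE /andP[p0 p1] /andP[e0 e1] indep.
(* Exponential Markov inequality with t = e / 4, which minimizes 2 t^2 - t e. *)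
pose t := e / 4.
pose c := (p + e) *+ n.
pose wt (f : {ffun 'I_n -> bool}) : R :=
  expR (- (t * c)) * \prod_(k < n) ((if f k then p else 1 - p) * expR (t * (f k)%:R)).
have wt0 f : 0 <= wt f.
  rewrite mulr_ge0 ?expR_ge0// prodr_ge0// => k _.
  by rewrite mulr_ge0 ?expR_ge0//; case: (f k); lra.
(* The tail event is covered by the atoms with at least [c] successes. For such an atom [wt f] is
   its probability times exp(t (successes - c)), a factor at least 1. *)
pose F (f : {ffun 'I_n -> bool}) := if c <= \sum_(k < n) (f k)%:R then atom E f else set0.
apply: (@le_trans _ _ (\sum_f wt f)%:E).
  apply: (@finite_union_bound _ _ F).
  - exact: measurable_count_ge.
  - by move=> f; rewrite /F; case: ifPn => // _; exact: measurable_atom.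
  - move=> w /= cw; exists [ffun k : 'I_n => w \in E k].
    rewrite /F; under eq_bigr do rewrite ffunE -indicE.
    rewrite cw => k _ /=; rewrite ffunE; case: ifPn => [/set_mem//|/negP h Ekw].
    by apply: h; exact: mem_set.
  - move=> f; rewrite /F; case: ifPn => [cf|_]; last by rewrite measure0 lee_fin.
    rewrite indep lee_fin /wt big_split/= mulrCA -expR_sum ler_peMr//.
      by rewrite prodr_ge0// => k _; case: (f k); lra.
    rewrite -expRD -mulr_sumr addrC -mulrBr -[leLHS]expR0 ler_expR mulr_ge0 ?subr_ge0//.
    by rewrite /t; lra.
rewrite lee_fin /wt -mulr_sumr.
(* Summed over all signatures, the product becomes the n-th power of p e^t + 1 - p, which is at most
   1 + p t + 2 t^2, hence at most exp(p t + 2 t^2). *)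
rewrite -(bigA_distr_bigA (fun (k : 'I_n) b => (if b then p else 1 - p) * expR (t * b%:R)))/=.
under eq_bigr do rewrite big_bool/=.
rewrite prodr_const card_ord mulr1 mulr0 expR0 mulr1.
apply: (@le_trans _ _ (expR (- (t * c)) * expR (p * t + 2 * t ^+ 2) ^+ n)).
  rewrite ler_wpM2l ?expR_ge0// lerXn2r ?nnegrE ?expR_ge0//.
    by rewrite addr_ge0 ?mulr_ge0 ?expR_ge0//; lra.
  apply: le_trans (expR_ge1Dx _).
  have : expR t <= 1 + t + 2 * t ^+ 2 by apply: expR_le_quadratic; rewrite /t; lra.
  have : 0 <= t ^+ 2 by rewrite sqr_ge0.
  by nra.
rewrite -expRM_natl -expRD ler_expR /c.
rewrite -(mulr_natr (p + e)) -(mulr_natr (e ^+ 2 / 8)) /t.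
have : 0 <= n%:R :> R by [].
have -> : - (e / 4 * ((p + e) * n%:R)) + n%:R * (p * (e / 4) + 2 * (e / 4) ^+ 2)
  = - (e ^+ 2 / 8 * n%:R) by field.
by [].
Qed.

End chernoff.

(** * Copulas and Markov kernels *)

Section copula.
Context {R : realType}.
Variables (A : R -> R -> R) (mu : probability (R * R)%type R).
Hypothesis cA : copula_measure A mu.

Lemma copula_strip_fst (x x' y : R) : 0 <= x <= x' -> x' <= 1 -> 0 <= y <= 1 ->
  mu (`]x, x'] `*` `[0, y]) = (A x' y - A x y)%:E.
Proof.
move=> /andP[x0 xx'] x'1 y01; have [_ muA _] := cA.
have x01 : 0 <= x <= 1 by lra.
have x'01 : 0 <= x' <= 1 by lra.
have mm (I J : interval R) : measurable ([set` I] `*` [set` J]).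
  by apply: measurableX; exact: measurable_itv.
have UE : `[0, x'] `*` `[0, y] = (`[0, x] `*` `[0, y]) `|` (`]x, x'] `*` `[0, y]).
  apply/seteqP; split => -[s t] /=; rewrite !in_itv/=.
    by move=> [? ->]; case: (leP s x) => ?; [left|right]; split => //; lra.
  by move=> [[? ->]|[? ->]]; split => //; lra.
have : (mu (`[0%R, x'] `*` `[0%R, y]) =
    mu (`[0%R, x] `*` `[0%R, y]) + mu (`]x, x'] `*` `[0%R, y]))%E.
  rewrite UE measureU//; apply/seteqP; split => // -[s t] /=.
  by rewrite !in_itv/= => -[[? _] [? _]]; lra.
have : mu (`]x, x'] `*` `[0, y]) \is a fin_num by rewrite fin_num_measure.
by rewrite !muA// => /fineK <-; rewrite -EFinD => -[->]; congr EFin; lra.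
Qed.

Lemma copula_strip_snd (x y y' : R) : 0 <= y <= y' -> y' <= 1 -> 0 <= x <= 1 ->
  mu (`[0, x] `*` `]y, y']) = (A x y' - A x y)%:E.
Proof.
move=> /andP[y0 yy'] y'1 x01; have [_ muA _] := cA.
have y01 : 0 <= y <= 1 by lra.
have y'01 : 0 <= y' <= 1 by lra.
have mm (I J : interval R) : measurable ([set` I] `*` [set` J]).
  by apply: measurableX; exact: measurable_itv.
have UE : `[0, x] `*` `[0, y'] = (`[0, x] `*` `[0, y]) `|` (`[0, x] `*` `]y, y']).
  apply/seteqP; split => -[s t] /=; rewrite !in_itv/=.
    by move=> [-> ?]; case: (leP t y) => ?; [left|right]; split => //; lra.
  by move=> [[-> ?]|[-> ?]]; split => //; lra.
have : (mu (`[0%R, x] `*` `[0%R, y']) =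
    mu (`[0%R, x] `*` `[0%R, y]) + mu (`[0%R, x] `*` `]y, y']))%E.
  rewrite UE measureU//; apply/seteqP; split => // -[s t] /=.
  by rewrite !in_itv/= => -[[_ ?] [_ ?]]; lra.
have : mu (`[0, x] `*` `]y, y']) \is a fin_num by rewrite fin_num_measure.
by rewrite !muA// => /fineK <-; rewrite -EFinD => -[->]; congr EFin; lra.
Qed.

(** The strip over []x, x']] of height [y] lies in the strip of full height, whose mass is x' - x
    because the marginals are uniform. *)
Lemma copula_lipschitz_fst (x x' y : R) : 0 <= x <= x' -> x' <= 1 -> 0 <= y <= 1 ->
  0 <= A x' y - A x y <= x' - x.
Proof.
move=> xx' x'1 y01; have [_ _ A1] := cA.
rewrite -2!lee_fin -copula_strip_fst// measure_ge0/=.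
have -> : x' - x = A x' 1 - A x 1 by rewrite !(A1 _ _).1//; lra.
rewrite -copula_strip_fst ?ler01 ?lexx//.
apply: le_measure; [| |]; try by apply: mem_set; apply: measurableX; exact: measurable_itv.
by move=> [s t] /=; rewrite !in_itv/= => -[-> ?]; split => //; lra.
Qed.

Lemma copula_lipschitz_snd (x y y' : R) : 0 <= y <= y' -> y' <= 1 -> 0 <= x <= 1 ->
  0 <= A x y' - A x y <= y' - y.
Proof.
move=> yy' y'1 x01; have [_ _ A1] := cA.
rewrite -2!lee_fin -copula_strip_snd// measure_ge0/=.
have -> : y' - y = A 1 y' - A 1 y by rewrite !(A1 _ _).2//; lra.
rewrite -copula_strip_snd ?ler01 ?lexx//.
apply: le_measure; [| |]; try by apply: mem_set; apply: measurableX; exact: measurable_itv.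
by move=> [s t] /=; rewrite !in_itv/= => -[? ->]; split => //; lra.
Qed.

Lemma copula_lipschitz (x x' y y' : R) :
  0 <= x <= 1 -> 0 <= x' <= 1 -> 0 <= y <= 1 -> 0 <= y' <= 1 ->
  `|A x y - A x' y'| <= `|x - x'| + `|y - y'|.
Proof.
move=> x01 x'01 y01 y'01.
have -> : A x y - A x' y' = (A x y - A x' y) + (A x' y - A x' y') by lra.
apply: (le_trans (ler_normD _ _)); apply: lerD.
  case: (leP x x') => xx'.
    have /andP[h1 h2] : 0 <= A x' y - A x y <= x' - x.
      by apply: copula_lipschitz_fst => //; lra.
    by rewrite distrC (distrC x) !ger0_norm// subr_ge0.
  have /andP[h1 h2] : 0 <= A x y - A x' y <= x - x'.
    by apply: copula_lipschitz_fst => //; lra.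
  by rewrite !ger0_norm// subr_ge0 ltW.
case: (leP y y') => yy'.
  have /andP[h1 h2] : 0 <= A x' y' - A x' y <= y' - y.
    by apply: copula_lipschitz_snd => //; lra.
  by rewrite distrC (distrC y) !ger0_norm// subr_ge0.
have /andP[h1 h2] : 0 <= A x' y - A x' y' <= y - y'.
  by apply: copula_lipschitz_snd => //; lra.
by rewrite !ger0_norm// subr_ge0 ltW.
Qed.

Lemma copula0r (x : R) : 0 <= x <= 1 -> A x 0 = 0.
Proof.
move=> x01; have [_ muA A1] := cA.
have h1 : 0 <= A x 0 by rewrite -lee_fin -muA// lexx ler01.
have h2 : 0 <= A 1 0 - A x 0 <= 1 - x by apply: copula_lipschitz_fst; lra.
have [_ h3] : A 0 1 = 0 /\ A 1 0 = 0 by apply: A1; rewrite lexx ler01.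
lra.
Qed.

End copula.

(** The increment of [A] is the integral of the kernel over []a, b]], so closeness of the kernel to
    a constant passes to its mean. *)
Lemma markov_kernel_average {R : realType} (A : R -> R -> R)
    (K : R -> {measure set R -> \bar R}) (a b v c e : R) :
  is_markov_kernel A K -> 0 <= a < b -> b <= 1 -> 0 <= v <= 1 ->
  (forall t, a < t <= b -> `|fine (K t `[0, v]%classic) - c| <= e) ->
  `|(A b v - A a v) - c * (b - a)| <= e * (b - a).
Proof.
move=> [mK K1 [mu [cA KE]]] /andP[a0 ab] b1 v01 Kc.
have sub1 (x y : R) (p q : bool) : 0 <= x -> y <= 1 ->
    [set` Interval (BSide p x) (BSide q y)] `<=` @unitI R.
  by move=> x0 y1 z; rewrite /unitI/= !in_itv/=; case: p; case: q => /=; lra.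
have mv : measurable (`[0, v]%classic : set R) by exact: measurable_itv.
have sv : `[0, v]%classic `<=` @unitI R by apply: sub1 => //; lra.
have sab : `]a, b]%classic `<=` @unitI R by apply: sub1 => //; lra.
have mab : measurable (`]a, b]%classic : set R) by exact: measurable_itv.
have := KE _ _ mab sab mv sv.
have aleb : 0 <= a <= b by lra.
rewrite (copula_strip_fst cA aleb b1 v01).
move=> IE.
have Kfin t : a < t <= b -> K t `[0, v]%classic \is a fin_num.
  move=> tab; rewrite ge0_fin_numE//.
  apply: (@le_lt_trans _ _ 1%E); last by rewrite ltry.
  rewrite -(K1 t); last by lra.
  by apply: le_measure => //; apply: mem_set; exact: measurable_itv.
have mKv : measurable_fun `]a, b]%classic (fun t => K t `[0, v]%classic).
  by apply: measurable_funS (mK _ mv sv) => //; exact: measurable_itv.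
have intc (r : R) :
  (\int[lebesgue_measure]_(x in `]a, b]%classic) (r%:E) = (r * (b - a))%:E)%E.
  rewrite integral_cst//= lebesgue_measure_itv/= lte_fin ab.
  by rewrite -EFinB -EFinM.
have ce : 0 <= c + e.
  have := Kc b; rewrite ab lexx => /(_ isT); rewrite ler_norml.
  have : 0 <= fine (K b `[0, v]%classic) by apply: fine_ge0.
  lra.
have up : A b v - A a v <= (c + e) * (b - a).
  rewrite -lee_fin -IE -intc; apply: ge0_le_integral => //.
  by move=> x /=; rewrite in_itv/= => xab; rewrite -(fineK (Kfin _ xab)) lee_fin;
      have := Kc x xab; rewrite ler_norml; lra.
have lo : (c - e) * (b - a) <= A b v - A a v.
  (* Integrals are compared between nonnegative functions; if c - e is not positive, the lower bound
     follows from the increment being nonnegative. *)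
  case: (leP (c - e) 0) => [ce0|ce0].
    apply: (@le_trans _ _ 0); first by rewrite mulr_le0_ge0//; lra.
    by rewrite -lee_fin -IE integral_ge0.
  rewrite -lee_fin -IE -intc; apply: ge0_le_integral => //.
  - by move=> x _; rewrite lee_fin ltW.
  by move=> x /=; rewrite in_itv/= => xab; rewrite -(fineK (Kfin _ xab)) lee_fin;
      have := Kc x xab; rewrite ler_norml; lra.
rewrite ler_norml; nra.
Qed.

(** Heine-Cantor from the near-covering form of compactness. Distances are kept coordinatewise, the
    shape in which cells and marginal deviations provide them. *)
Lemma compact_unif_continuous {R : realType} (D : set (R * R)) (f : R * R -> R) :
  compact D -> {within D, continuous f} ->
  forall e, 0 < e -> exists2 r, 0 < r & forall p q, D p -> D q ->
    `|p.1 - q.1| < r -> `|p.2 - q.2| < r -> `|f p - f q| < e.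
Proof.
move=> /compact_near_coveringP /near_covering_withinP ncD cf e e0.
pose Q r p := forall q, D q ->
   `|p.1 - q.1| < r -> `|p.2 - q.2| < r -> `|f p - f q| < e.
have H : \forall r \near (0 : R)^'+, D `<=` Q r.
  apply: ncD => -[x1 x2] Dx.
  have /subspace_continuousP/(_ _ Dx)/cvgrPdist_lt/(_ (e / 2)) := cf.
  rewrite divr_gt0// => /(_ isT).
  rewrite /within/= => -[[U V]/= [/nbhs_ballP[r1/= r10 B1] /nbhs_ballP[r2/= r20 B2]]] UV.
  (* Halving leaves room for two displacements, from the centre to [p] and from [p] to [q]. *)
  pose r := Num.min r1 r2 / 2.
  have r0 : 0 < r by rewrite divr_gt0// lt_min r10.
  have [rr1 rr2] : r + r <= r1 /\ r + r <= r2.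
    by rewrite /r -splitr; split; rewrite ge_min lexx ?orbT.
  exists (ball (x1, x2) r, [set s | 0 < s < r]) => /=.
    split; first exact: nbhsx_ballx.
    near=> s; apply/andP; split => //; near: s; exact: nbhs_right_lt.
  move=> [[p1 p2] s]/= [[/= b1 b2] /andP[s0 sr]] Dp [q1 q2]/= Dq pq1 pq2.
  move: b1 b2; rewrite /ball/= => b1 b2.
  have h : `|f (x1, x2) - f (p1, p2)| < e / 2.
    apply: (UV (p1, p2)) => //; split => /=; [apply: B1|apply: B2]; rewrite /ball/=; lra.
  have h' : `|f (x1, x2) - f (q1, q2)| < e / 2.
    apply: (UV (q1, q2)) => //; split => /=; [apply: B1|apply: B2]; rewrite /ball/=.
      have := ler_distD p1 x1 q1; lra.
    have := ler_distD p2 x2 q2; lra.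
  have := ler_distD (f (x1, x2)) (f (p1, p2)) (f (q1, q2)).
  rewrite (distrC (f (p1, p2)) (f (x1, x2))); lra.
near (0 : R)^'+ => r.
exists r => [|p q Dp Dq]; first by near: r; exact: nbhs_right_gt.
by have : D `<=` Q r by [near: r]; apply.
Unshelve. all: by end_near. Qed.

(** * The checkerboard kernel *)

Section checkerboard.
Context {R : realType}.
Implicit Types (B : R -> R -> R) (u v : R) (N i j : nat).

(** Take the least [i] with u <= (i+1)/N. The cells are half-open, except that the first contains 0,
    so no other cell contains [u]. *)
Lemma cb_int_cell N u : (0 < N)%N -> 0 <= u <= 1 ->
  exists i, [/\ (i < N)%N, i%:R / N%:R <= u <= i.+1%:R / N%:R, cb_int N i u &
    forall k, (k < N)%N -> cb_int N k u -> k = i].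
Proof.
move=> N0 /andP[u0 u1]; have N0' : 0 < N%:R :> R by rewrite ltr0n.
have ex : exists i, u <= i.+1%:R / N%:R.
  by exists N.-1; rewrite prednK// divff ?gt_eqF.
case: (ex_minnP ex) => i ui imin; exists i.
have iN : (i < N)%N.
  by rewrite -(prednK N0) ltnS; apply: imin; rewrite prednK// divff ?gt_eqF.
have ltu k : (k < i)%N -> k.+1%:R / N%:R < u.
  by move=> ki; rewrite ltNge; apply/negP => /imin; rewrite leqNgt ki.
have lei : i%:R / N%:R <= u.
  by case: i ltu {ui imin iN} => [|i] ltu; rewrite ?mul0r// ltW// ltu.
split => //; first by rewrite lei.
  rewrite /cb_int; case: eqP => [i0|/eqP i0] /=; rewrite in_itv/=.
    by rewrite u0 -[N%:R^-1]mul1r -[1]/(1%:R) -{1}i0.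
  by rewrite ui andbT; move: i0 ltu; case: i {ex ui imin iN lei} => // i _ /(_ i (leqnn _)).
move=> k kN.
have kmin : u <= k.+1%:R / N%:R -> (i <= k)%N by apply: imin.
rewrite /cb_int; case: eqP => [k0|/eqP k0] /=; rewrite in_itv/=.
  move=> /andP[_ uN]; apply/eqP; rewrite eqn_leq kmin ?andbT//; first by rewrite k0.
  by rewrite k0 mul1r.
move=> /andP[ku uk]; apply/eqP; rewrite eqn_leq kmin// andbT leqNgt.
apply/negP => ik; have : i.+1%:R / N%:R <= k%:R / N%:R :> R.
  by rewrite ler_pM2r ?invr_gt0// ler_nat.
lra.
Qed.

(** Written as an increment of k -> min(v, k/N), the overlap has one formula for cells below, around
    and above [v]. *)
Lemma lebesgue_cb_int N j v : (0 < N)%N -> 0 <= v <= 1 ->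
  fine (lebesgue_measure (`[0, v] `&` cb_int N j)) =
  Num.min v (j.+1%:R / N%:R) - Num.min v (j%:R / N%:R).
Proof.
move=> N0 /andP[v0 v1]; have N0' : 0 < N%:R :> R by rewrite ltr0n.
rewrite /cb_int; case: eqP => [->|/eqP j0].
  rewrite mul1r mul0r (min_r v0) subr0.
  have -> : `[0, v] `&` `[0, N%:R^-1] = `[0, Num.min v N%:R^-1]%classic.
    apply/seteqP; split => z /=; rewrite !in_itv/= le_min.
      by move=> [/andP[-> ->] /andP[_ ->]].
    by move=> /andP[-> /andP[-> ->]].
  rewrite lebesgue_measure_itv/= lte_fin; case: ifPn; first by rewrite oppr0 addr0.
  rewrite -leNgt => h; apply/eqP; rewrite eq_sym eq_le h le_min v0/= invr_ge0.
  exact: ltW.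
have -> : `[0, v] `&` `]j%:R / N%:R, j.+1%:R / N%:R] =
    `]j%:R / N%:R, Num.min v (j.+1%:R / N%:R)]%classic.
  have jN : 0 <= j%:R / N%:R :> R by rewrite divr_ge0.
  apply/seteqP; split => z /=; rewrite !in_itv/= le_min.
    by move=> [/andP[z0 ->] /andP[-> ->]].
  by move=> /andP[jz /andP[-> ->]]; rewrite jz; split => //; rewrite andbT; lra.
have jj : j%:R / N%:R < j.+1%:R / N%:R :> R by rewrite ltr_pM2r ?invr_gt0// ltr_nat.
rewrite lebesgue_measure_itv/= lte_fin lt_min jj andbT; case: (ltP (j%:R / N%:R) v) => [h|h].
  by rewrite -EFinD.
by rewrite /= min_l ?subrr// (le_trans h)// ltW.
Qed.

Definition cb_incr N i B j :=
  B (i.+1%:R / N%:R) (j%:R / N%:R) - B (i%:R / N%:R) (j%:R / N%:R).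

Lemma cb_kernelE N u v : (0 < N)%N -> 0 <= u <= 1 -> 0 <= v <= 1 ->
  exists i j (t : R), [/\ (i < N)%N && (j < N)%N, i%:R / N%:R <= u <= i.+1%:R / N%:R,
    j%:R / N%:R <= v <= j.+1%:R / N%:R, 0 <= t <= 1 &
    forall B, cb_kernel N B u v = N%:R * ((1 - t) * cb_incr N i B j
      + t * cb_incr N i B j.+1 - cb_incr N i B 0)].
Proof.
move=> N0 u01 v01; have N0' : 0 < N%:R :> R by rewrite ltr0n.
have [i [iN iu ciu iuniq]] := cb_int_cell N0 u01.
have [j [jN jv _ _]] := cb_int_cell N0 v01.
exists i, j, (N%:R * v - j%:R); split => //; first by rewrite iN.
  move: jv; rewrite ler_pdivrMr// ler_pdivlMr// mulrC -natr1; lra.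
move=> B; rewrite /cb_kernel (bigD1 (Ordinal iN))//= [X in _ + X]big1 ?addr0; last first.
  move=> k ki; rewrite big1// => l _; rewrite indicE memNset ?mulr0 ?mul0r//.
  move=> /(iuniq _ (ltn_ord k)) ki'; move/eqP: ki; apply; exact: val_inj.
rewrite indicE mem_set//.
under eq_bigr do rewrite mulr1 lebesgue_cb_int//.
(* The weight [m k.+1 - m k] is 1/N below cell [j], v - j/N at [j] and 0 above. The masses below [j]
   telescope, and the one at [j] gets weight t/N with t = N v - j. *)
pose m k : R := Num.min v (k%:R / N%:R).
pose D := cb_incr N i B.
have E k : cb_mass B N i k = D k.+1 - D k by rewrite /cb_mass /rect_mass /D /cb_incr; ring.
under eq_bigr do rewrite E.
rewrite -(big_mkord xpredT (fun k => (D k.+1 - D k) * (m k.+1 - m k))).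
have mlo k : (k <= j)%N -> m k = k%:R / N%:R.
  move=> kj; rewrite /m min_r//; apply: (@le_trans _ _ (j%:R / N%:R)).
    by rewrite ler_pM2r ?invr_gt0// ler_nat.
  by case/andP: jv.
have mhi k : (j < k)%N -> m k = v.
  move=> kj; rewrite /m min_l//; apply: (@le_trans _ _ (j.+1%:R / N%:R)).
    by case/andP: jv.
  by rewrite ler_pM2r ?invr_gt0// ler_nat.
rewrite (@big_cat_nat _ _ _ j)//=; last exact: ltnW.
have tail0 : \sum_(j.+1 <= k < N) (D k.+1 - D k) * (m k.+1 - m k) = 0.
  by rewrite big_nat big1// => k /andP[jk _]; rewrite !mhi ?subrr ?mulr0// ltnW.
rewrite (big_ltn jN) tail0 addr0.
rewrite (@eq_big_nat _ _ _ _ _ _ (fun k => (D k.+1 - D k) * N%:R^-1)); last first.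
  move=> k /andP[_ kj]; rewrite (mlo k.+1)// (mlo k) 1?ltnW//; congr (_ * _).
  by rewrite -natr1; ring.
rewrite -mulr_suml telescope_sumr// mhi// mlo//.
by rewrite -/(D j) -/(D 0%N) -/(D j.+1); field; rewrite gt_eqF.
Qed.

(** [B] is a function close to [A], so its increment at height 0 may be nonzero and must be
    estimated as well: the convex combination and the height 0 cost 2 delta each, whence 4 N delta.
    The term [w] is the oscillation of the kernel at distance 1/N. *)
Lemma cb_kernel_error (A B : R -> R -> R) (K : R -> {measure set R -> \bar R})
    (N : nat) (delta w u v : R) :
  is_markov_kernel A K -> (0 < N)%N ->
  (forall x y, 0 <= x <= 1 -> 0 <= y <= 1 -> `|B x y - A x y| <= delta) ->
  (forall x x' y y', 0 <= x <= 1 -> 0 <= x' <= 1 -> 0 <= y <= 1 -> 0 <= y' <= 1 ->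
    `|x - x'| <= N%:R^-1 -> `|y - y'| <= N%:R^-1 ->
    `|fine (K x `[0, y]%classic) - fine (K x' `[0, y']%classic)| <= w) ->
  0 <= u <= 1 -> 0 <= v <= 1 ->
  `|cb_kernel N B u v - fine (K u `[0, v]%classic)| <= 4 * (N%:R * delta) + w.
Proof.
move=> KA N0 BA Kw u01 v01; have N0' : 0 < N%:R :> R by rewrite ltr0n.
have [_ _ [mu [cA _]]] := KA.
have [i [j [t [/andP[iN jN] iu jv t01 ->]]]] := cb_kernelE N0 u01 v01.
have N1 : N%:R * N%:R^-1 = 1 :> R by rewrite divff// gt_eqF.
have g01 (k : nat) : (k <= N)%N -> 0 <= (k%:R / N%:R : R) <= 1.
  by move=> kN; rewrite divr_ge0//= ler_pdivrMr// mul1r ler_nat.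
have gS k : k.+1%:R / N%:R = k%:R / N%:R + N%:R^-1 :> R by rewrite -natr1 mulrDl mul1r.
set c := fine _.
have BD k : (k <= N)%N -> `|cb_incr N i B k - cb_incr N i A k| <= 2 * delta.
  move=> kN; have := BA _ _ (g01 i.+1 iN) (g01 k kN).
  have := BA _ _ (g01 i (ltnW iN)) (g01 k kN).
  by rewrite /cb_incr !ler_norml; lra.
(* Both heights are within 1/N of [v] and the whole column is within 1/N of [u], so the kernel
   there, and hence its mean, is within [w] of [c]. *)
have AK k : (j <= k <= j.+1)%N -> `|N%:R * cb_incr N i A k - c| <= w.
  move=> kj; have kN : (k <= N)%N by case/andP: kj => _ /leq_trans; apply.
  have kv : `|k%:R / N%:R - v| <= N%:R^-1.
    move: jv; rewrite gS ler_norml; move: kj; rewrite leq_eqVlt => /andP[/orP[/eqP<- _|jk kj]].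
      lra.
    have -> : k = j.+1 by apply/eqP; rewrite eqn_leq kj.
    rewrite gS; lra.
  have [gi gi1] := (g01 i (ltnW iN), g01 i.+1 iN).
  have h : `|cb_incr N i A k - c * N%:R^-1| <= w * N%:R^-1.
    have -> : N%:R^-1 = i.+1%:R / N%:R - i%:R / N%:R :> R by rewrite gS; lra.
    apply: (markov_kernel_average KA).
    - by rewrite gS ltrDl invr_gt0 N0'; case/andP: gi => ->.
    - by case/andP: gi1.
    - exact: g01.
    - move=> s si; apply: Kw => //; [lra|exact: g01|].
      by rewrite ler_norml; rewrite gS in si iu; lra.
  have -> : N%:R * cb_incr N i A k - c = N%:R * (cb_incr N i A k - c * N%:R^-1).
    by field; rewrite gt_eqF.
  by rewrite normrM gtr0_norm// mulrC -ler_pdivlMr.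
have A0 : cb_incr N i A 0 = 0.
  by rewrite /cb_incr mul0r !(copula0r cA) ?subrr// g01// ltnW.
have := BD 0%N (leq0n _); rewrite A0 subr0.
have := BD j (ltnW jN); have := BD j.+1 jN.
have := AK j; rewrite leqnn leqnSn => /(_ isT).
have := AK j.+1; rewrite leqnn leqnSn => /(_ isT).
set a1 := cb_incr N i A j.+1; set a0 := cb_incr N i A j.
set b1 := cb_incr N i B j.+1; set b0 := cb_incr N i B j; set z := cb_incr N i B 0.
move=> k1 k0 d1 d0 dz.
have -> : N%:R * ((1 - t) * b0 + t * b1 - z) - c =
  N%:R * ((1 - t) * (b0 - a0) + t * (b1 - a1) - z)
  + ((1 - t) * (N%:R * a0 - c) + t * (N%:R * a1 - c)) by ring.
apply: (le_trans (ler_normD _ _)); apply: lerD.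
  rewrite normrM gtr0_norm// mulrCA ler_pM2l//.
  move: d1 d0 dz; rewrite !ler_norml => d1 d0 dz.
  have : - (2 * delta) <= (1 - t) * (b0 - a0) + t * (b1 - a1) <= 2 * delta by nra.
  lra.
move: k1 k0; rewrite !ler_norml; set x := _ - c; set y := _ - c; nra.
Qed.

End checkerboard.

(** * The empirical copula *)

Section empirical_copula.
Context {R : realType}.
Implicit Types (X Y : nat -> R) (n : nat).

Lemma emp_df_count X n x :
  emp_df X n x = (count (fun z => z <= x)%R (map X (iota 0 n)))%:R / n%:R.
Proof.
rewrite /emp_df mulrC; congr (_ / _).
rewrite -sum1_count big_map natr_sum -[in RHS](subn0 n) -/(index_iota 0 n).
rewrite [RHS]big_mkcond/= big_mkord.
by apply: eq_bigr => k _; case: ifP.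
Qed.

(** Without ties, exactly i observations are at most the order statistic of rank i; level 0 is
    attained to the left of the whole sample. *)
Lemma emp_df_surj X n i : (0 < n)%N -> (i <= n)%N ->
  (forall k l, (k < n)%N -> (l < n)%N -> X k = X l -> k = l) ->
  exists x, emp_df X n x = i%:R / n%:R.
Proof.
move=> n0; case: i => [_ _|i ilen Xinj].
  exists (- 1 - \sum_(k < n) `|X k|); rewrite /emp_df mul0r big1 ?mulr0// => k _.
  rewrite lt_geF// (bigD1 k)//=.
  have : 0 <= \sum_(i < n | i != k) `|X i| by rewrite sumr_ge0.
  have := ler_norm (- X k); rewrite normrN; lra.
pose s := sort <=%O (map X (iota 0 n)).
have us : uniq (map X (iota 0 n)).
  rewrite map_inj_in_uniq ?iota_uniq// => k l.
  by rewrite !mem_iota !add0n /=; exact: Xinj.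
(* Level 0 has been split off, so the level sought is i+1: position [i], counted from 0, has rank
   i+1. *)
exists (nth 0 s i); rewrite emp_df_count; congr (_%:R / _).
have /permP <- : perm_eq s (map X (iota 0 n)) by rewrite perm_sort.
by rewrite count_le_nth ?sort_lt_sorted// size_sort size_map size_iota.
Qed.

Lemma cellP n (u : R) : (0 < n)%N -> 0 <= u <= 1 ->
  (cell n u < n)%N /\ (cell n u)%:R <= n%:R * u <= (cell n u).+1%:R.
Proof.
move=> n0 /andP[u0 u1]; have nu0 : 0 <= n%:R * u by rewrite mulr_ge0.
have /andP[tl th] := truncn_itv nu0.
rewrite /cell /minn; case: ifPn => [tn|].
  by split; [rewrite (leq_trans tn)// leq_pred|rewrite tl ltW].
rewrite -leqNgt prednK// => nt; split => //.
rewrite ler_piMr// andbT (le_trans _ tl)// ler_nat//.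
Qed.

Variables (A : R -> R -> R) (mu : probability (R * R)%type R).
Hypothesis cA : copula_measure A mu.
Variables (X Y : nat -> R) (n : nat) (F G : R -> R) (e : R).
Hypothesis n0 : (0 < n)%N.
Hypothesis Xinj : forall k l, (k < n)%N -> (l < n)%N -> X k = X l -> k = l.
Hypothesis Yinj : forall k l, (k < n)%N -> (l < n)%N -> Y k = Y l -> k = l.
Hypothesis F01 : forall x, 0 <= F x <= 1.
Hypothesis G01 : forall x, 0 <= G x <= 1.
Hypothesis Fe : forall x, `|emp_df X n x - F x| <= e.
Hypothesis Ge : forall y, `|emp_df Y n y - G y| <= e.
Hypothesis He : forall x y, `|emp_joint_df X Y n x y - A (F x) (G y)| <= e.

(** Whichever point [xget] selects at the levels i/n and j/n, replacing H_n by H there costs [e],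
    and moving from its F and G values to the levels costs [e] per coordinate by the Lipschitz
    property. *)
Lemma emp_subcopula_error i j : (i <= n)%N -> (j <= n)%N ->
  `|emp_subcopula X Y n i j - A (i%:R / n%:R) (j%:R / n%:R)| <= 3 * e.
Proof.
move=> ilen jlen; have n0' : 0 < n%:R :> R by rewrite ltr0n.
have g01 (k : nat) : (k <= n)%N -> 0 <= (k%:R / n%:R : R) <= 1.
  by move=> kn; rewrite divr_ge0//= ler_pdivrMr// mul1r ler_nat.
rewrite /emp_subcopula; set S := [set p | _]; set p := xget _ _.
have [x Fx] := emp_df_surj n0 ilen Xinj; have [y Gy] := emp_df_surj n0 jlen Yinj.
have [p1 p2] : S p by apply: (@xgetPex _ (0, 0) S); exists (x, y).
have := He p.1 p.2; have := Fe p.1; have := Ge p.2; rewrite p1 p2.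
rewrite (distrC _ (F _)) (distrC _ (G _)).
have := copula_lipschitz cA (F01 p.1) (g01 _ ilen) (G01 p.2) (g01 _ jlen).
have := ler_distD (A (F p.1) (G p.2)) (emp_joint_df X Y n p.1 p.2)
  (A (i%:R / n%:R) (j%:R / n%:R)).
lra.
Qed.

(** The corners of the cell are within 1/n of (u, v) in each coordinate, whence 2/n by the Lipschitz
    property. Bilinear interpolation is a convex combination in [u] followed by one in [v], so it
    keeps the corner bound. *)
Lemma emp_copula_error u v : 0 <= u <= 1 -> 0 <= v <= 1 ->
  `|emp_copula X Y n u v - A u v| <= 3 * e + 2 / n%:R.
Proof.
move=> u01 v01; have n0' : 0 < n%:R :> R by rewrite ltr0n.
have g01 (k : nat) : (k <= n)%N -> 0 <= (k%:R / n%:R : R) <= 1.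
  by move=> kn; rewrite divr_ge0//= ler_pdivrMr// mul1r ler_nat.
rewrite /emp_copula.
have [] := cellP n0 u01; set i := cell n u => ilt iu.
have [] := cellP n0 v01; set j := cell n v => jlt jv.
set t := n%:R * u - i%:R; set r := n%:R * v - j%:R.
have t01 : 0 <= t <= 1 by move: iu; rewrite /t -natr1; lra.
have r01 : 0 <= r <= 1 by move: jv; rewrite /r -natr1; lra.
have near k (w : R) : k%:R <= n%:R * w + 1 -> n%:R * w <= k%:R + 1 ->
    `|k%:R / n%:R - w| <= n%:R^-1.
  move=> h1 h2; have -> : k%:R / n%:R - w = (k%:R - n%:R * w) / n%:R.
    by rewrite mulrBl mulrAC divff ?mul1r// gt_eqF.
  rewrite normrM (gtr0_norm (_ : 0 < n%:R^-1)) ?invr_gt0//.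
  by rewrite ler_piMl ?invr_ge0// ler_norml; lra.
have corner k l : (i <= k <= i.+1)%N -> (j <= l <= j.+1)%N ->
    `|emp_subcopula X Y n k l - A u v| <= 3 * e + 2 / n%:R.
  move=> /andP[ik ki] /andP[jl lj].
  have [kn ln] : (k <= n)%N /\ (l <= n)%N.
    by split; [exact: leq_trans ki _|exact: leq_trans lj _].
  have := emp_subcopula_error kn ln.
  have := copula_lipschitz cA (g01 _ kn) u01 (g01 _ ln) v01.
  move: ik ki jl lj; rewrite -!(ler_nat R) -!natr1 => ik ki jl lj.
  have := near k u; have := near l v.
  rewrite -!natr1 in iu jv.
  move=> /(_ ltac:(lra) ltac:(lra)) h1 /(_ ltac:(lra) ltac:(lra)) h2.
  have := ler_distD (A (k%:R / n%:R) (l%:R / n%:R)) (emp_subcopula X Y n k l) (A u v).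
  lra.
have := corner i j; have := corner i.+1 j; have := corner i j.+1; have := corner i.+1 j.+1.
rewrite !leqnn !leqnSn => /(_ isT isT) + /(_ isT isT) + /(_ isT isT) + /(_ isT isT).
set c11 := emp_subcopula X Y n i.+1 j.+1; set c01 := emp_subcopula X Y n i j.+1.
set c10 := emp_subcopula X Y n i.+1 j; set c00 := emp_subcopula X Y n i j.
set b := 3 * e + 2 / n%:R; rewrite !ler_norml => h11 h01 h10 h00.
have conv (s x y : R) : 0 <= s <= 1 -> - b <= x <= b -> - b <= y <= b ->
  - b <= (1 - s) * x + s * y <= b by nra.
have := conv _ _ _ r01 (conv _ _ _ t01 h00 h10) (conv _ _ _ t01 h01 h11).
lra.
Qed.

End empirical_copula.

(** * Tail bounds for i.i.d. pairs *)

Section iid.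
Context {R : realType} {d : measure_display} {Omega : measurableType d}.
Variables (P : probability Omega R) (X Y : nat -> Omega -> R).
Hypothesis iid : iid_pairs P X Y.

Let mX k : measurable_fun setT (X k). Proof. by case: iid. Qed.
Let mY k : measurable_fun setT (Y k). Proof. by case: iid => _ []. Qed.

Lemma measurable_pairRV k (B : set (R * R)) :
  measurable B -> measurable (pairRV X Y k @^-1` B).
Proof.
move=> mB; rewrite -[X in measurable X]setTI.
by have /= := measurable_fun_pair (mX k) (mY k); apply.
Qed.

Lemma pairRV_identical k (B : set (R * R)) : measurable B ->
  P (pairRV X Y k @^-1` B) = (fine (P (pairRV X Y 0 @^-1` B)))%:E.
Proof.
move=> mB; have [_ [_ [_ ->//]]] := iid.
by rewrite fineK// fin_num_measure//; exact: measurable_pairRV.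
Qed.

Lemma pairRV_atom n (B : set (R * R)) (f : {ffun 'I_n -> bool}) : measurable B ->
  let p := fine (P (pairRV X Y 0 @^-1` B)) in
  P (atom (fun k => pairRV X Y k @^-1` B) f)
  = (\prod_(k < n) (if f k then p else 1 - p))%:E.
Proof.
move=> mB p.
(* Independence is stated for families indexed by all naturals; [setT] is a filler beyond [n],
   outside the finite index set used below. *)
pose C (k : nat) : set (R * R) :=
  if insub k is Some i then (if f i then B else ~` B) else setT.
have mC k : measurable (C k).
  rewrite /C; case: insubP => // i _ _.
  by case: (f i) => //; exact: measurableC.
have PC (k : 'I_n) : P (pairRV X Y k @^-1` C k) = (if f k then p else 1 - p)%:E.
  rewrite /C valK; case: (f k); first exact: pairRV_identical.
  rewrite preimage_setC probability_setC; last exact: measurable_pairRV.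
  by rewrite pairRV_identical// -EFinB.
have [_ [_ [indep _]]] := iid.
have := indep [fset k in iota 0 n]%fset C mC.
rewrite (perm_big (iota 0 n)); last first.
  by apply: uniq_perm; [exact: fset_uniq|exact: iota_uniq|by move=> k; rewrite !inE].
rewrite -[X in iota 0 X](subn0 n) -/(index_iota 0 n) big_mkord.
rewrite (eq_bigr _ (fun k _ => PC k)) => E.
rewrite -prodEFin -E; congr (P _).
apply/seteqP; split => w /=.
- move=> h k /=; rewrite !inE/= mem_iota add0n subn0 => /andP[_ kn].
  have := h (Ordinal kn) I; rewrite /C (insubT (fun k => (k < n)%N) kn)/=.
  by case: (f _).
- move=> h k _; have := h k; rewrite /= !inE mem_iota add0n subn0/= ltn_ord => /(_ isT).
  by rewrite /C valK; case: (f k).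
Qed.

Lemma pairRV_indep2 k l (B : set (R * R)) : k != l -> measurable B ->
  P (pairRV X Y k @^-1` B `&` pairRV X Y l @^-1` B) =
  (fine (P (pairRV X Y 0 @^-1` B)) ^+ 2)%:E.
Proof.
move=> kl mB; have [_ [_ [indep _]]] := iid.
have := indep [fset k; l]%fset (fun=> B) (fun=> mB).
rewrite (perm_big [:: k; l]); last first.
  apply: uniq_perm; rewrite ?fset_uniq//=; first by rewrite inE andbT.
  by move=> j; rewrite !inE.
rewrite !big_cons big_nil /= mule1 (pairRV_identical k)// (pairRV_identical l)//.
rewrite -EFinM -expr2 => <-.
congr (P _); apply/seteqP; split => w /=.
- by move=> [wk wl] j /=; rewrite !inE => /orP[] /eqP ->.
- by move=> h; split; apply: h; rewrite /= !inE eqxx ?orbT.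
Qed.

Lemma iid_upper_tail n (B : set (R * R)) (e : R) : measurable B -> 0 <= e <= 1 ->
  (P [set w | (fine (P (pairRV X Y 0 @^-1` B)) + e) *+ n <=
              \sum_(k < n) \1_(pairRV X Y k @^-1` B) w]%R
    <= (expR (- (e ^+ 2 / 8 *+ n)))%:E)%E.
Proof.
move=> mB e01; apply: (@chernoff _ _ _ P n (fun k => pairRV X Y k @^-1` B)) => //.
- by move=> k; exact: measurable_pairRV.
- have mE := measurable_pairRV 0 mB.
  by rewrite -2!lee_fin fineK ?fin_num_measure// measure_ge0 probability_le1.
- by move=> f; exact: pairRV_atom.
Qed.

(** This is the upper tail of the complement: its count is n minus the count of [B], and its
    probability is 1 - p. *)
Lemma iid_lower_tail n (B : set (R * R)) (e : R) : measurable B -> 0 <= e <= 1 ->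
  (P [set w | \sum_(k < n) \1_(pairRV X Y k @^-1` B) w <=
              (fine (P (pairRV X Y 0 @^-1` B)) - e) *+ n]%R
    <= (expR (- (e ^+ 2 / 8 *+ n)))%:E)%E.
Proof.
move=> mB e01; have := @iid_upper_tail n (~` B) e (measurableC mB) e01.
have mE := measurable_pairRV 0 mB.
have indC (D : set Omega) w : \1_(~` D) w = 1 - \1_D w :> R.
  by rewrite indicC indicE; case: (w \in D); rewrite ?subrr ?subr0.
have S w : \sum_(k < n) \1_(pairRV X Y k @^-1` (~` B)) w =
    n%:R - \sum_(k < n) \1_(pairRV X Y k @^-1` B) w :> R.
  under eq_bigr do rewrite preimage_setC indC.
  by rewrite sumrB sumr_const card_ord.
rewrite preimage_setC probability_setC// fineB ?fin_num_measure//=.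
congr (P _ <= _)%E; apply/seteqP; split => w /=;
  rewrite S -(mulr_natr (1 - _ + e)) -(mulr_natr (_ - e)); lra.
Qed.

End iid.

(** * Quantiles and joint distribution functions *)

Section quantile_brackets.
Context {R : realType}.
Variable F : R -> R.
Hypothesis F_nd : {homo F : x y / x <= y}.
Hypothesis F_cont : continuous F.
Hypothesis F_y : F x @[x --> +oo] --> (1 : R).
Hypothesis F_Ny : F x @[x --> -oo] --> (0 : R).

Definition ext_df (x : \bar R) : R :=
  match x with EFin r => F r | EPInf => 1 | ENInf => 0 end.

Lemma quantile_exists (p : R) : 0 < p < 1 -> exists r, F r = p.
Proof.
move=> /andP[p0 p1].
have [a ap] : exists a, F a < p.
  by apply: (@filter_ex _ (-oo)%R); move/cvgr_lt : F_Ny; apply.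
have [b pb] : exists b, p < F b.
  by apply: (@filter_ex _ (+oo)%R); move/cvgr_gt : F_y; apply.
have ab : a <= b.
  by rewrite leNgt; apply/negP => /ltW/F_nd; rewrite leNgt (lt_trans ap pb).
have [|c _ <-] := @IVT R F a b p ab (continuous_subspaceT F_cont).
  by rewrite min_l ?max_r ?(ltW ap) ?(ltW pb)// F_nd.
by exists c.
Qed.

(** The levels 0 and 1 may not be attained by [F], so they are placed at infinity. *)
Definition quantile (n i : nat) : \bar R :=
  if i == 0 then -oo%E else if (n <= i)%N then +oo%E
  else (xget 0 [set r | F r = i%:R / n%:R])%:E.

Lemma ext_df_quantile n i : (0 < n)%N ->
  ext_df (quantile n i) = (minn i n)%:R / n%:R.
Proof.
move=> n0; have n0' : 0 < n%:R :> R by rewrite ltr0n.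
rewrite /quantile; case: eqP => [->|/eqP i0]; first by rewrite min0n mul0r.
case: ifPn => [ni|]; first by rewrite (minn_idPr ni) divff// gt_eqF.
rewrite -ltnNge => ilt; rewrite (minn_idPl (ltnW ilt))/=.
have [r Fr] : exists r, F r = i%:R / n%:R.
  apply: quantile_exists; rewrite divr_gt0//= ?ltr0n ?lt0n//.
  by rewrite ltr_pdivrMr// mul1r ltr_nat.
exact: (@xgetPex _ 0 [set r | F r = i%:R / n%:R] (ex_intro _ r Fr)).
Qed.

(* [F] may be flat at a quantile, so the brackets of [x] go one level beyond the
   level [l] with l/n <= F x < (l+1)/n; this forces a strict inequality on [a]. *)
Lemma quantile_brackets n : (0 < n)%N -> exists a b : nat -> \bar R,
  (forall l, ext_df (b l) - ext_df (a l) <= 2 / n%:R) /\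
  (forall x, x != -oo%E -> exists2 l, (l < n.+1)%N & (a l < x <= b l)%E).
Proof.
move=> n0; have n0' : 0 < n%:R :> R by rewrite ltr0n.
exists (fun l => quantile n l.-1), (fun l => quantile n l.+1); split.
  move=> l; rewrite !ext_df_quantile// -mulrBl ler_pM2r ?invr_gt0//.
  rewrite lerBlDr -natrD ler_nat.
  by lia.
case => [r| |]// _; last first.
  exists n => //; apply/andP; split; last by rewrite /quantile/= leqnSn.
  by rewrite /quantile; case: eqP => //; rewrite leqNgt prednK ?leqnn//= ltry.
have Fr0 : 0 <= F r 
  by apply: (cvgr_to_le F_Ny); near=> x; apply: F_nd;
    near: x; apply: nbhs_ninfty_le; exact: num_real.
have Fr1 : F r <= 1 
  by apply: (cvgr_to_ge F_y); near=> x; apply: F_nd;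
    near: x; apply: nbhs_pinfty_ge; exact: num_real.
have nF0 : 0 <= n%:R * F r by rewrite mulr_ge0.
have /andP[tl th] := truncn_itv nF0; set l := Num.truncn _ in tl th.
(* Equality occurs when F r = 1, hence n+1 brackets rather than n. *)
have ln : (l <= n)%N by rewrite -(ler_nat R) (le_trans tl)// ler_piMr.
exists l => //; apply/andP; split.
  rewrite ltNge; apply/negP => h.
  have l0 : (0 < l.-1)%N by move: h; rewrite /quantile lt0n; case: eqP.
  have : F r <= ext_df (quantile n l.-1).
    move: h; case: (quantile n l.-1) => [z| |]//=; rewrite lee_fin; exact: F_nd.
  rewrite ext_df_quantile// ler_pdivlMr// mulrC => h'.
  have := le_trans tl h'; rewrite ler_nat /minn; case: ifP; lia.
rewrite leNgt; apply/negP => h.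
have : ext_df (quantile n l.+1) <= F r.
  move: h; case: (quantile n l.+1) => [z| |]//=; rewrite lte_fin => /ltW; exact: F_nd.
rewrite ext_df_quantile// ler_pdivrMr// mulrC; move: h; rewrite /quantile/=.
case: ifPn => [nl|]; first by rewrite ltNge leey.
rewrite -ltnNge => nl _; rewrite (minn_idPl (ltnW nl)); lra.
Unshelve. all: by end_near. Qed.

End quantile_brackets.

Section joint_distribution.
Context {R : realType} {d : measure_display} {Omega : measurableType d}.
Variable P : probability Omega R.
Implicit Types (X Y : Omega -> R) (a b : \bar R).

(** At +oo this is the whole line and at -oo it is empty, so marginal distribution functions are
    joint ones with one threshold at +oo. *)
Definition half a : set R := [set x | (x%:E <= a)%E].

Lemma measurable_half a : measurable (half a).
Proof.
case: a => [r| |].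
- have -> : half r%:E = `]-oo, r]%classic; last exact: measurable_itv.
  by apply/seteqP; split => x; rewrite /half/= in_itv/= lee_fin.
- have -> : half +oo = setT; last exact: measurableT.
  by apply/seteqP; split => x; rewrite /half/= ?leey.
- have -> : half -oo = set0; last exact: measurable0.
  by apply/seteqP; split => x; rewrite /half/= ?leNgt ?ltNyr.
Qed.

Lemma half_subset a b : (a <= b)%E -> half a `<=` half b.
Proof. by move=> ab x xa; exact: le_trans ab. Qed.

Definition lowset a b : set (R * R) := half a `*` half b.

Lemma measurable_lowset a b : measurable (lowset a b).
Proof. by apply: measurableX; exact: measurable_half. Qed.

Variables (Z : Omega -> R * R).
Hypothesis mZ : measurable_fun setT Z.

Let mE (B : set (R * R)) : measurable B -> measurable (Z @^-1` B).
Proof. by move=> mB; rewrite -[X in measurable X]setTI; exact: mZ. Qed.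

Definition ext_joint_df a b : R := fine (P (Z @^-1` lowset a b)).
Local Notation q := ext_joint_df.

Lemma fine_prob_setD (B C : set (R * R)) : measurable B -> measurable C -> B `<=` C ->
  fine (P (Z @^-1` (C `\` B))) = fine (P (Z @^-1` C)) - fine (P (Z @^-1` B)).
Proof.
move=> mB mC BC; have [mB' mC'] := (mE mB, mE mC).
have -> : Z @^-1` (C `\` B) = (Z @^-1` C) `\` (Z @^-1` B) by [].
rewrite measureD// ?fineB ?fin_num_measure//; last 2 first.
- exact: measurableI.
- by rewrite ltey_eq fin_num_measure.
congr (_ - fine (P _)); apply/seteqP; split => w //= => [[]//|wB].
by split => //; exact: BC.
Qed.

Lemma fine_prob_le (B C : set (R * R)) : measurable B -> measurable C -> B `<=` C ->
  fine (P (Z @^-1` B)) <= fine (P (Z @^-1` C)).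
Proof.
move=> mB mC BC; rewrite fine_le ?fin_num_measure//; try exact: mE.
by apply: le_measure; [apply: mem_set; exact: mE.. | move=> w; exact: BC].
Qed.

Lemma ext_joint_df_nd a a' b b' : (a <= a')%E -> (b <= b')%E -> q a b <= q a' b'.
Proof.
move=> aa bb; apply: fine_prob_le; try exact: measurable_lowset.
by move=> [x y] [/= xa yb]; split => /=; [exact: half_subset xa|exact: half_subset yb].
Qed.

(** The L-shaped difference of two quadrants is covered by a vertical and a horizontal strip.
    Marginal brackets therefore control joint increments. *)
Lemma ext_joint_df_lipschitz a a' b b' : (a <= a')%E -> (b <= b')%E ->
  q a' b' - q a b <= (q a' +oo%E - q a +oo%E) + (q +oo%E b' - q +oo%E b).
Proof.
move=> aa bb.
have S (a1 a2 b1 b2 : \bar R) : (a1 <= a2)%E -> (b1 <= b2)%E -> lowset a1 b1 `<=` lowset a2 b2.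
  by move=> ? ? [x y] [/= xa yb]; split => /=; [exact: half_subset xa|exact: half_subset yb].
rewrite /q -!fine_prob_setD; try exact: measurable_lowset; try exact: S.
set B0 := _ `\` _; set B1 := _ `\` _; set B2 := _ `\` _.
have [m0 [m1 m2]] : measurable B0 /\ measurable B1 /\ measurable B2.
  by split; [|split]; apply: measurableD; exact: measurable_lowset.
rewrite -fineD ?fin_num_measure//; try exact: mE.
rewrite fine_le ?fin_numD ?fin_num_measure//; try exact: mE.
apply: (@le_trans _ _ (P (Z @^-1` (B1 `|` B2)))).
  apply: le_measure; [apply: mem_set|apply: mem_set|]; try apply: mE => //.
    exact: measurableU.
  move=> w [/= [wa wb] nw]; rewrite /B1 /B2 /lowset /=.
  have [h|h] := pselect (half a (Z w).1); [right|left].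
    by split; [split => //=; rewrite /half/= leey|move=> [_ hb]; apply: nw].
  by split; [split => //=; rewrite /half/= leey|move=> [ha _]; apply: h].
by rewrite preimage_setU; apply: measureU2; exact: mE.
Qed.

End joint_distribution.

(** The error 1 - G y does not depend on [x], so [F] is a uniform limit of the continuous functions
    [H ^~ y]. *)
Lemma continuous_uniform_approx {R : realType} (F G : R -> R) (H : R -> R -> R) :
  (forall y, continuous (H ^~ y)) -> G y @[y --> +oo] --> (1 : R) ->
  (forall x y, `|F x - H x y| <= 1 - G y) -> continuous F.
Proof.
move=> Hc G1 FH x; apply/cvgrPdist_lt => e e0.
have e3 : 0 < e / 3 by rewrite divr_gt0.
have [y Gy] : exists y, 1 - e / 3 < G y.
  apply: (@filter_ex _ (+oo)%R); move/cvgr_gt : G1; apply; lra.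
have /cvgrPdist_lt/(_ _ e3) := Hc y x; apply: filterS => z Hz.
have := FH x y; have := FH z y; rewrite (distrC (F z)) => h1 h2.
have := ler_distD (H x y) (F x) (F z); have := ler_distD (H z y) (H x y) (F z).
lra.
Qed.

Section marginals.
Context {R : realType} {d : measure_display} {Omega : measurableType d}.
Variable P : probability Omega R.

Lemma marg_df_nd (W : Omega -> R) : measurable_fun setT W ->
  {homo marg_df P W : x y / x <= y}.
Proof.
move=> mW x y xy; have m z : measurable [set w | W w <= z].
  have := mW measurableT _ (measurable_itv `]-oo, z]).
  by rewrite setTI; congr measurable; apply/seteqP; split => w /=; rewrite in_itv.
rewrite /marg_df fine_le ?fin_num_measure//.
apply: le_measure; [exact: mem_set..|] => w /= /le_trans; exact.
Qed.

Lemma marg_df_cvg (W : Omega -> R) : measurable_fun setT W ->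
  (marg_df P W x @[x --> +oo] --> (1 : R)) /\ (marg_df P W x @[x --> -oo] --> (0 : R)).
Proof.
move=> mW; pose W' : {mfun Omega >-> R} := mfun_Sub (mem_set mW).
have E : marg_df P W = fine \o cdf (P := P) W'.
  apply/funext => x; rewrite /marg_df /cdf /distribution /pushforward/=.
  by congr (fine (P _)); apply/seteqP; split => w /=; rewrite in_itv.
by rewrite E; split; apply: fine_cvg; [exact: cvg_cdfy1|exact: cvg_cdfNy0].
Qed.

Lemma marg_df_01 (W : Omega -> R) x : measurable_fun setT W -> 0 <= marg_df P W x <= 1.
Proof.
move=> mW; have m : measurable [set w | W w <= x].
  have := mW measurableT _ (measurable_itv `]-oo, x]).
  by rewrite setTI; congr measurable; apply/seteqP; split => w /=; rewrite in_itv.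
by rewrite /marg_df -2!lee_fin fineK ?fin_num_measure// measure_ge0 probability_le1.
Qed.

Variables (X Y : Omega -> R).
Hypotheses (mX : measurable_fun setT X) (mY : measurable_fun setT Y).
Let Z w : R * R := (X w, Y w).
Let mZ : measurable_fun setT Z. Proof. exact: measurable_fun_pair. Qed.
Local Notation q := (ext_joint_df P Z).

Lemma ext_joint_df_fin x y : q x%:E y%:E = joint_df P X Y x y.
Proof.
by [].
Qed.

Lemma ext_joint_df_fst a : q a +oo%E = ext_df (marg_df P X) a.
Proof.
rewrite /ext_joint_df; case: a => [x| |] /=.
- rewrite /marg_df; congr (fine (P _)).
  apply/seteqP; split => w; rewrite /lowset /half /= ?lee_fin; first by case.
  by move=> ?; split => //; rewrite leey.
- rewrite (_ : _ @^-1` _ = setT) ?probability_setT//.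
  by apply/seteqP; split => // w _; split; rewrite /half/= leey.
- rewrite (_ : _ @^-1` _ = set0) ?measure0//.
  by apply/seteqP; split => // w [/=]; rewrite /half/= leNgt ltNyr.
Qed.

Lemma ext_joint_df_snd b : q +oo%E b = ext_df (marg_df P Y) b.
Proof.
rewrite /ext_joint_df; case: b => [x| |] /=.
- rewrite /marg_df; congr (fine (P _)).
  apply/seteqP; split => w; rewrite /lowset /half /= ?lee_fin; first by case.
  by move=> ?; split => //; rewrite leey.
- rewrite (_ : _ @^-1` _ = setT) ?probability_setT//.
  by apply/seteqP; split => // w _; split; rewrite /half/= leey.
- rewrite (_ : _ @^-1` _ = set0) ?measure0//.
  by apply/seteqP; split => // w [/=]; rewrite /half/= => _; rewrite leNgt ltNyr.
Qed.

Hypothesis Hc : continuous (fun p : R * R => joint_df P X Y p.1 p.2).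

(** F(x) - H(x, y) is the probability that X <= x and Y > y, hence at most 1 - G(y); symmetrically
    for G. *)
Lemma marg_df_continuous : continuous (marg_df P X) /\ continuous (marg_df P Y).
Proof.
have [X1 _] := marg_df_cvg mX; have [Y1 _] := marg_df_cvg mY.
split.
- apply: (@continuous_uniform_approx _ _ (marg_df P Y) (joint_df P X Y)) => //.
    move=> y x; exact: (cvg_comp2 (f := id) (g := fun=> y) (h := joint_df P X Y)
      cvg_id (cvg_cst y) (@Hc (x, y))).
  move=> x y; rewrite -ext_joint_df_fin -[marg_df P X x]/(ext_df (marg_df P X) x%:E).
  rewrite -[marg_df P Y y]/(ext_df (marg_df P Y) y%:E).
  rewrite -[1]/(ext_df (marg_df P Y) +oo%E) -ext_joint_df_fst -!ext_joint_df_snd.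
  rewrite ger0_norm ?subr_ge0.
    have := @ext_joint_df_lipschitz _ _ _ P Z mZ x%:E x%:E y%:E +oo%E (lexx _) (leey _).
    lra.
  by apply: ext_joint_df_nd; rewrite ?leey.
- apply: (@continuous_uniform_approx _ _ (marg_df P X) (fun y x => joint_df P X Y x y)) => //.
    move=> x y; exact: (cvg_comp2 (f := fun=> x) (g := id) (h := joint_df P X Y)
      (cvg_cst x) cvg_id (@Hc (x, y))).
  move=> y x; rewrite -ext_joint_df_fin -[marg_df P X x]/(ext_df (marg_df P X) x%:E).
  rewrite -[marg_df P Y y]/(ext_df (marg_df P Y) y%:E).
  rewrite -[1]/(ext_df (marg_df P X) +oo%E) -!ext_joint_df_fst -ext_joint_df_snd.
  rewrite ger0_norm ?subr_ge0.
    have := @ext_joint_df_lipschitz _ _ _ P Z mZ x%:E +oo%E y%:E y%:E (leey _) (lexx _).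
    lra.
  by apply: ext_joint_df_nd; rewrite ?leey.
Qed.

Lemma ext_df_brackets n : (0 < n)%N -> exists a b a' b' : nat -> \bar R,
  [/\ forall l, q (b l) +oo%E - q (a l) +oo%E <= 2 / n%:R,
   forall l, q +oo%E (b' l) - q +oo%E (a' l) <= 2 / n%:R,
   forall x, x != -oo%E -> exists2 l, (l < n.+1)%N & (a l < x <= b l)%E &
   forall x, x != -oo%E -> exists2 l, (l < n.+1)%N & (a' l < x <= b' l)%E].
Proof.
move=> n0; have [Fc Gc] := marg_df_continuous.
have [F1 F0] := marg_df_cvg mX; have [G1 G0] := marg_df_cvg mY.
have [a [b [ab abx]]] := quantile_brackets (marg_df_nd mX) Fc F1 F0 n0.
have [a' [b' [ab' abx']]] := quantile_brackets (marg_df_nd mY) Gc G1 G0 n0.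
by exists a, b, a', b'; split => // l; rewrite ?ext_joint_df_fst ?ext_joint_df_snd.
Qed.

End marginals.

(** * Uniform deviation of the empirical distribution function *)

Section uniform_deviation.
Context {R : realType} {d : measure_display} {Omega : measurableType d}.
Variables (P : probability Omega R) (X Y : nat -> Omega -> R).
Hypothesis iid : iid_pairs P X Y.
Hypothesis Hc : continuous (fun p : R * R => joint_df P (X 0%N) (Y 0%N) p.1 p.2).

Let mX k : measurable_fun setT (X k). Proof. by case: iid. Qed.
Let mY k : measurable_fun setT (Y k). Proof. by case: iid => _ []. Qed.
Let Z := pairRV X Y 0.
Let mZ : measurable_fun setT Z. Proof. exact: measurable_fun_pair. Qed.
Local Notation q := (ext_joint_df P Z).

Definition ext_count n (a b : \bar R) (w : Omega) : R :=
  \sum_(k < n) \1_(pairRV X Y k @^-1` lowset a b) w.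

Lemma ext_count_nd n a a' b b' w : (a <= a')%E -> (b <= b')%E ->
  ext_count n a b w <= ext_count n a' b' w.
Proof.
move=> aa bb; apply: ler_sum => k _; rewrite !indicE ler_nat.
case: (boolP (w \in pairRV X Y k @^-1` lowset a b)) => // /set_mem [/= xa yb].
by rewrite mem_set//; split => /=; [exact: half_subset xa|exact: half_subset yb].
Qed.

(** One-sided tails suffice: upper tails at the upper corners of the brackets and lower tails at the
    lower ones, 2 (n+1)^2 events in all. The two corners around (x, y) differ by at most 2/n per
    coordinate, whence 4/n. *)
Lemma uniform_deviation n (e : R) : (0 < n)%N -> 0 <= e <= 1 ->
  exists Bad : set Omega, [/\ measurable Bad,
    (P Bad <= (2 * (n.+1%:R ^+ 2) * expR (- (e ^+ 2 / 8 *+ n)))%:E)%E &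
    forall w, ~ Bad w -> forall x y, x != -oo%E -> y != -oo%E ->
      `|n%:R^-1 * ext_count n x y w - q x y| <= e + 4 / n%:R].
Proof.
move=> n0 e01; have n0' : 0 < n%:R :> R by rewrite ltr0n.
have [a [b [a' [b' [ab ab' abx aby]]]]] := ext_df_brackets (mX 0) (mY 0) Hc n0.
pose T (i : 'I_n.+1 * 'I_n.+1 * bool) : set Omega :=
  if i.2 then [set w | (q (b i.1.1) (b' i.1.2) + e) *+ n <= ext_count n (b i.1.1) (b' i.1.2) w]
  else [set w | ext_count n (a i.1.1) (a' i.1.2) w <= (q (a i.1.1) (a' i.1.2) - e) *+ n].
have mT i : measurable (T i).
  have mL u v k : measurable (pairRV X Y k @^-1` lowset u v).
    by apply: (measurable_pairRV iid); exact: measurable_lowset.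
  rewrite /T; case: i.2.
    by apply: (@measurable_count_ge _ _ _ n (fun k => pairRV X Y k @^-1` lowset _ _)).
  by apply: (@measurable_count_le _ _ _ n (fun k => pairRV X Y k @^-1` lowset _ _)).
exists (\bigcup_(i in [set: 'I_n.+1 * 'I_n.+1 * bool]) T i).
have mB : measurable (\bigcup_(i in [set: 'I_n.+1 * 'I_n.+1 * bool]) T i).
  exact: fin_bigcup_measurable.
split => //.
- have -> : 2 * (n.+1%:R ^+ 2) * expR (- (e ^+ 2 / 8 *+ n)) =
      \sum_(i : 'I_n.+1 * 'I_n.+1 * bool) expR (- (e ^+ 2 / 8 *+ n)) :> R.
    rewrite sumr_const !card_prod card_ord card_bool -[RHS]mulr_natl.
    by congr (_ * _); rewrite !natrM expr2 mulrC.
  apply: (finite_union_bound mB mT); first by move=> w [i _ Ti]; exists i.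
  move=> [[l m] []]; rewrite /T/=.
    by apply: (iid_upper_tail iid) => //; exact: measurable_lowset.
  by apply: (iid_lower_tail iid) => //; exact: measurable_lowset.
move=> w nBw x y x0 y0.
have [l ln /andP[al lb]] := abx x x0; have [m mn /andP[am mb]] := aby y y0.
have up : ext_count n (b l) (b' m) w < (q (b l) (b' m) + e) *+ n.
  rewrite ltNge; apply/negP => h; apply: nBw.
  by exists (Ordinal ln, Ordinal mn, true).
have lo : (q (a l) (a' m) - e) *+ n < ext_count n (a l) (a' m) w.
  rewrite ltNge; apply/negP => h; apply: nBw.
  by exists (Ordinal ln, Ordinal mn, false).
have cu := @ext_count_nd n _ _ _ _ w lb mb.
have cl := @ext_count_nd n _ _ _ _ w (ltW al) (ltW am).
have gap := @ext_joint_df_lipschitz _ _ _ P Z mZ _ _ _ _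
  (le_trans (ltW al) lb) (le_trans (ltW am) mb).
have qu : q x y <= q (b l) (b' m) by exact: ext_joint_df_nd.
have ql : q (a l) (a' m) <= q x y by apply: ext_joint_df_nd => //; exact: ltW.
have := ab l; have := ab' m => gl gm.
rewrite -(mulr_natl _ n) in up; rewrite -(mulr_natl _ n) in lo.
have h4 : 4 / n%:R = 2 / n%:R + 2 / n%:R :> R by rewrite -mulrDl; congr (_ / _); lra.
have h1 : n%:R^-1 * ext_count n x y w <= q (b l) (b' m) + e.
  by rewrite ler_pdivrMl// (le_trans cu)// ltW.
have h2 : q (a l) (a' m) - e <= n%:R^-1 * ext_count n x y w.
  by rewrite ler_pdivlMl// (le_trans _ cl)// ltW.
rewrite ler_norml h4; lra.
Qed.

(* A tie puts both points in one of the n+1 sets, each of probability at most 2/n: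
   total at most (n+1) (2/n)^2. *)
Lemma no_tie_of_cover (T : Type) (g : R * R -> T) (k l : nat) : k != l ->
  (forall n, (0 < n)%N -> exists B : nat -> set (R * R),
    [/\ forall j, measurable (B j), forall j, fine (P (Z @^-1` B j)) <= 2 / n%:R &
      forall z z', g z = g z' -> exists2 j, (j < n.+1)%N & B j z /\ B j z']) ->
  P.-negligible [set w | g (pairRV X Y k w) = g (pairRV X Y l w)].
Proof.
move=> kl cover.
pose D (B : nat -> set (R * R)) j := pairRV X Y k @^-1` B j `&` pairRV X Y l @^-1` B j.
have H n : exists C : set Omega, [/\ measurable C,
    [set w | g (pairRV X Y k w) = g (pairRV X Y l w)] `<=` C &
    (P C <= (8 / n.+1%:R)%:E)%E].
  have n0' : 0 < n.+1%:R :> R by rewrite ltr0n.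
  have [B [mB PB Bc]] := cover n.+1 isT.
  have mD (j : 'I_n.+2) : measurable (D B j).
    by apply: measurableI; apply: (measurable_pairRV iid).
  have mC : measurable (\bigcup_(j in [set: 'I_n.+2]) D B j).
    exact: fin_bigcup_measurable.
  exists (\bigcup_(j in [set: 'I_n.+2]) D B j); split => //.
    move=> w /Bc [j jn [Bk Bl]].
    by exists (Ordinal jn).
  apply: (@le_trans _ _ (\sum_(j < n.+2) (2 / n.+1%:R) ^+ 2 : R)%:E).
    apply: (finite_union_bound mC mD); first by move=> w [j _ Dj]; exists j.
    move=> j; rewrite /D (pairRV_indep2 iid kl)// lee_fin lerXn2r ?nnegrE//.
    by apply: fine_ge0.
  rewrite lee_fin sumr_const card_ord -[leLHS]mulr_natl -(natr1 n.+1).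
  have t1 : n.+1%:R^-1 <= 1 :> R by rewrite invf_le1// ler1n.
  have t0 : 0 <= n.+1%:R^-1 :> R by rewrite invr_ge0.
  have Nt : n.+1%:R * n.+1%:R^-1 = 1 :> R by rewrite divff ?gt_eqF.
  move: t0 t1 Nt; set t := n.+1%:R^-1; set N := n.+1%:R => t0 t1 Nt.
  (* With N t = 1 and t <= 1 the total is 4 t + 4 t^2, at most 8 t. *)
  have -> : (N + 1) * (2 * t) ^+ 2 = 4 * t * (N * t) + 4 * t * t by ring.
  rewrite Nt; nra.
have {H} [C CP] := choice H.
exists (\bigcap_n C n); split.
- by apply: bigcap_measurable => // n _; case: (CP n).
- apply/eqP; rewrite eq_le measure_ge0 andbT; apply/lee_addgt0Pr => e e0.
  rewrite add0e.
  have [n ne] : exists n : nat, 8 / e < n.+1%:R.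
    by exists (Num.truncn (8 / e)); rewrite truncnS_gt.
  have [mC _ PC] := CP n.
  apply: (@le_trans _ _ (P (C n))).
    apply: le_measure; [apply: mem_set|exact: mem_set|].
      by apply: bigcap_measurable => // m _; case: (CP m).
    exact: bigcap_inf.
  apply: (le_trans PC); rewrite lee_fin ler_pdivrMr ?ltr0n//.
  by move: ne; rewrite ltr_pdivrMr// mulrC => /ltW.
- by move=> w tie n _; case: (CP n) => _ + _; apply.
Qed.

Lemma no_ties k l : k != l ->
  P.-negligible [set w | X k w = X l w] /\ P.-negligible [set w | Y k w = Y l w].
Proof.
move=> kl; split.
- apply: (@no_tie_of_cover _ fst k l kl) => n n0.
  have [a [b [_ [_ [ab _ abx _]]]]] := ext_df_brackets (mX 0) (mY 0) Hc n0.
  exists (fun j => lowset (b j) +oo `\` lowset (a j) +oo); split.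
  + by move=> j; apply: measurableD; exact: measurable_lowset.
  (* The order of [a j] and [b j] is not recorded by the brackets; if it is reversed, the strip is
     empty. *)
  + move=> j; case: (leP (a j) (b j)) => abj.
      rewrite (fine_prob_setD _ mZ); [exact: ab|exact: measurable_lowset..|].
      by move=> z [/= za zy]; split => //=; exact: half_subset za.
    rewrite (_ : _ `\` _ = set0) ?preimage_set0 ?measure0 ?divr_ge0//.
    apply/seteqP; split => // z [[/= zb zy] na]; apply: na; split => //=.
    by apply: half_subset zb; exact: ltW.
  + move=> [x y] [_ y'] /= <-; have [j jn /andP[aj jb]] := abx x%:E isT.
    by exists j => //; split; split; rewrite /lowset /half /= ?leey//;
      move=> [+ _]; apply/negP; rewrite -ltNge.
- apply: (@no_tie_of_cover _ snd k l kl) => n n0.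
  have [_ [_ [a [b [_ ab _ abx]]]]] := ext_df_brackets (mX 0) (mY 0) Hc n0.
  exists (fun j => lowset +oo (b j) `\` lowset +oo (a j)); split.
  + by move=> j; apply: measurableD; exact: measurable_lowset.
  + move=> j; case: (leP (a j) (b j)) => abj.
      rewrite (fine_prob_setD _ mZ); [exact: ab|exact: measurable_lowset..|].
      by move=> z [/= zx za]; split => //=; exact: half_subset za.
    rewrite (_ : _ `\` _ = set0) ?preimage_set0 ?measure0 ?divr_ge0//.
    apply/seteqP; split => // z [[/= zx zb] na]; apply: na; split => //=.
    by apply: half_subset zb; exact: ltW.
  + move=> [x y] [x' _] /= <-; have [j jn /andP[aj jb]] := abx y%:E isT.
    by exists j => //; split; split; rewrite /lowset /half /= ?leey//;
      move=> [_ +]; apply/negP; rewrite -ltNge.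
Qed.

End uniform_deviation.

(** * Almost sure rate *)

(** e^y is the m-th power of e^(y/m), and e^(y/m) >= 1 + y/m. This makes exp dominate a power of any
    degree. *)
Lemma pow_div_le_expR {R : realType} (y : R) (m : nat) : (0 < m)%N -> 0 <= y ->
  (y / m%:R) ^+ m <= expR y.
Proof.
move=> m0 y0; have m0' : 0 < m%:R :> R by rewrite ltr0n.
have -> : expR y = expR (y / m%:R) ^+ m.
  by rewrite -expRM_natl mulrC divfK// gt_eqF.
rewrite lerXn2r ?nnegrE ?expR_ge0 ?divr_ge0//.
by apply: le_trans (expR_ge1Dx _); rewrite lerDr.
Qed.

Lemma near_powR_gt {R : realType} (r M : R) : 0 < r ->
  \forall n \near \oo, M < n%:R `^ r.
Proof.
move=> r0; have M0 : 0 < `|M| + 1 by rewrite ltr_wpDl.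
near=> n; apply: (@lt_trans _ _ (`|M| + 1)); first by have := ler_norm M; lra.
have -> : `|M| + 1 = ((`|M| + 1) `^ r^-1) `^ r.
  by rewrite -powRrM mulVf ?gt_eqF// powRr1// ltW.
apply: gt0_ltr_powR => //; rewrite ?nnegrE ?powR_ge0//.
near: n; exact: nbhs_infty_gtr.
Unshelve. all: by end_near. Qed.

(** The right-hand side is chosen to telescope, so that summability needs no further comparison
    series. *)
Lemma stretched_exp_bound {R : realType} (c : R) : 0 < c -> exists C : R,
  forall n, (0 < n)%N ->
    2 * (n.+1%:R ^+ 2) * expR (- (n%:R `^ c / 8)) <= C * (n%:R^-1 - n.+1%:R^-1).
Proof.
(* With c m >= 4, exp(n^c / 8) is at least n^4 / (8 m)^m; the factor 16 comes from 2 n (n+1)^3 <= 2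
   n (2 n)^3. *)
move=> c0; pose m := (Num.truncn (4 / c)).+1.
have m0 : 0 < m%:R :> R by rewrite ltr0n.
have cm : 4 <= c * m%:R by rewrite mulrC -ler_pdivrMr// ltW// truncnS_gt.
exists (16 * (8 * m%:R) ^+ m) => n n0.
have n1 : 1 <= n%:R :> R by rewrite ler1n.
have n0' : 0 < n%:R :> R by rewrite ltr0n.
have -> : n%:R^-1 - n.+1%:R^-1 = (n%:R * n.+1%:R)^-1 :> R.
  by rewrite -natr1; field; rewrite !gt_eqF//; lra.
rewrite expRN; set E := expR _; have E0 : 0 < E by rewrite expR_gt0.
set D := (8 * m%:R) ^+ m; have D0 : 0 < D by rewrite exprn_gt0// mulr_gt0.
have nE : n%:R ^+ 4 <= D * E.
  have := @pow_div_le_expR R (n%:R `^ c / 8) m isT (divr_ge0 (powR_ge0 _ _) (ler0n _ _)).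
  rewrite -mulrA -invfM exprMn exprVn ler_pdivrMr// mulrC => h; apply: le_trans h.
  rewrite -(@powR_mulrn _ _ m (powR_ge0 _ _)) -powRrM -(@powR_mulrn _ _ 4 (ler0n _ _)).
  exact: ler_powR.
rewrite ler_pdivrMr// mulrAC ler_pdivlMr ?mulr_gt0// ?ltr0n//.
rewrite -natr1; apply: (@le_trans _ _ (16 * n%:R ^+ 4)); last by lra.
set x := n%:R in n1 n0' *.
have h : (x + 1) ^+ 3 <= (2 * x) ^+ 3 by rewrite lerXn2r ?nnegrE//; lra.
rewrite [leLHS](_ : _ = 2 * x * (x + 1) ^+ 3); last by ring.
have -> : 16 * x ^+ 4 = 2 * x * (2 * x) ^+ 3 by ring.
by rewrite ler_wpM2l//; lra.
Qed.

Lemma nneseries_telescope_lty {R : realType} (f : nat -> \bar R) (C : R) :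
  (forall n, (0 <= f n)%E) ->
  (forall n, (f n <= (C * (n.+1%:R^-1 - n.+2%:R^-1))%:E)%E) ->
  (\sum_(0 <= n <oo) f n < +oo)%E.
Proof.
move=> f0 fC.
have C0 : 0 <= C.
  have := le_trans (f0 0%N) (fC 0%N).
  by rewrite lee_fin pmulr_lge0// subr_gt0 ltf_pV2 ?posrE ?ltr0n ?ltr_nat.
apply: (@le_lt_trans _ _ C%:E); last by rewrite ltry.
apply: lime_le; first by apply: is_cvg_nneseries => n _ _.
apply: nearW => n; rewrite big_mkord.
apply: (@le_trans _ _ (\sum_(k < n) (C * (k.+1%:R^-1 - k.+2%:R^-1))%:E)%E).
  by apply: lee_sum => k _.
rewrite sumEFin lee_fin -mulr_sumr -[leRHS]mulr1 ler_wpM2l//.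
have -> : \sum_(k < n) (k.+1%:R^-1 - k.+2%:R^-1) = 1 - n.+1%:R^-1 :> R.
  elim: n => [|n IH]; first by rewrite big_ord0 invr1 subrr.
  by rewrite big_ord_recr/= IH addrA subrK.
by rewrite lerBlDr lerDl invr_ge0.
Qed.

Section almost_sure_rate.
Context {R : realType} {d : measure_display} {Omega : measurableType d}.
Variables (P : probability Omega R) (X Y : nat -> Omega -> R).
Hypothesis iid : iid_pairs P X Y.
Hypothesis Hc : continuous (fun p : R * R => joint_df P (X 0%N) (Y 0%N) p.1 p.2).

Lemma as_uniform_rate (r : R) : 0 < r < 2^-1 ->
  {ae P, forall w, \forall n \near \oo, forall x y, x != -oo%E -> y != -oo%E ->
      `|n%:R^-1 * ext_count X Y n x y w - ext_joint_df P (pairRV X Y 0) x y|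
      <= n%:R `^ (- r) + 4 / n%:R}.
Proof.
move=> /andP[r0 r2].
have e01 (n : nat) : 0 <= (n.+1%:R : R) `^ (- r) <= 1.
  by rewrite powR_ge0/= -[leRHS](powRr0 (n.+1%:R : R)); apply: ler_powR; [rewrite ler1n|lra].
(* [F n] is the bad event for sample size n+1, at precision e = (n+1)^-r; then e^2 (n+1) = (n+1)^(1
   - 2r). *)
have [F FP] := choice (fun n => uniform_deviation iid Hc (ltn0Sn n) (e01 n)).
have c0 : 0 < 1 - 2 * r by lra.
have [C Cb] := stretched_exp_bound c0.
have Fs : P (lim_sup_set F) = 0%E.
  apply: lim_sup_set_cvg0; first by move=> n; case: (FP n).
  apply: (@nneseries_telescope_lty _ _ C) => // n.
  have [_ PF _] := FP n; apply: (le_trans PF); rewrite lee_fin.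
  apply: le_trans (Cb n.+1 isT).
  have -> // : (n.+1%:R `^ (- r)) ^+ 2 / 8 *+ n.+1 = n.+1%:R `^ (1 - 2 * r) / 8 :> R.
  rewrite -mulr_natr mulrAC; congr (_ / _).
  rewrite -powR_mulrn ?powR_ge0// -powRrM -[X in _ * X]powRr1//.
  by rewrite -powRD ?pnatr_eq0 ?implybT//; congr (_ `^ _); lra.
exists (lim_sup_set F); split => //.
  by apply: bigcap_measurable => // n _; apply: bigcup_measurable => k _; case: (FP k).
move=> w /= nev N _.
apply: contrapT => nN; apply: nev; apply: (ex_intro2 _ _ N.+1) => //.
case=> [//|n] /= Nn.
by have [_ _] := FP n; apply => Fn; apply: nN; exists n.
Qed.

End almost_sure_rate.

(** * Consistency of the checkerboard kernel *)

Lemma sup_cvg0 {R : realType} (T : Type) (x0 : T) (f : nat -> T -> R) :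
  (forall n x, 0 <= f n x) ->
  (forall e, 0 < e -> \forall n \near \oo, forall x, f n x <= e) ->
  (fun n => sup (range (f n))) @ \oo --> (0 : R).
Proof.
move=> f0 fe; apply/cvgrPdist_le => e e0; near=> n.
have fn : forall x, f n x <= e by near: n; exact: fe.
have ne : range (f n) !=set0 by exists (f n x0), x0.
have ub : ubound (range (f n)) e by move=> _ [x _ <-].
rewrite sub0r normrN ger0_norm; first exact: ge_sup.
apply: (le_trans (f0 n x0)); apply: ub_le_sup; last by exists x0.
by exists e.
Unshelve. all: by end_near. Qed.

Lemma NresP {R : realType} (s : R) (n : nat) :
  (Nres s n)%:R <= n%:R `^ s < (Nres s n)%:R + 1.
Proof. by rewrite natr1; exact/truncn_itv/powR_ge0. Qed.

Lemma Nres_lt_near {R : realType} (s M : R) : 0 < s ->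
  \forall n \near \oo, M < (Nres s n)%:R.
Proof.
move=> s0; have := near_powR_gt (M + 1) s0.
by apply: filterS => n; have := NresP s n; lra.
Qed.

Lemma emp_df_01 {R : realType} (X : nat -> R) n x : 0 <= emp_df X n x <= 1.
Proof.
case: n => [|n]; first by rewrite /emp_df big_ord0 mulr0 lexx ler01.
rewrite /emp_df mulr_ge0 ?invr_ge0 ?sumr_ge0//= ler_pdivrMl ?ltr0n// mulr1.
apply: (@le_trans _ _ (\sum_(k < n.+1) 1)); last by rewrite sumr_const card_ord.
by apply: ler_sum => k _; case: (X k <= x)%R; rewrite ?ler01 ?lexx.
Qed.

Section empirical_counts.
Context {R : realType} {d : measure_display} {Omega : measurableType d}.
Variables (X Y : nat -> Omega -> R).

Lemma emp_joint_df_count n x y w :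
  emp_joint_df (X ^~ w) (Y ^~ w) n x y = n%:R^-1 * ext_count X Y n x%:E y%:E w.
Proof.
congr (_ * _); apply: eq_bigr => k _; rewrite indicE; congr (_%:R).
congr nat_of_bool; apply/idP/idP => [/andP[xk yk]|/set_mem []].
  by apply: mem_set; split; rewrite /half/= lee_fin.
by rewrite /half/= !lee_fin => -> ->.
Qed.

Lemma emp_df_fst_count n x w :
  emp_df (X ^~ w) n x = n%:R^-1 * ext_count X Y n x%:E +oo%E w.
Proof.
congr (_ * _); apply: eq_bigr => k _; rewrite indicE; congr (_%:R).
congr nat_of_bool; apply/idP/idP => [xk|/set_mem []].
  by apply: mem_set; split; rewrite /half/= ?lee_fin// leey.
by rewrite /half/= !lee_fin.
Qed.

Lemma emp_df_snd_count n y w :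
  emp_df (Y ^~ w) n y = n%:R^-1 * ext_count X Y n +oo%E y%:E w.
Proof.
congr (_ * _); apply: eq_bigr => k _; rewrite indicE; congr (_%:R).
congr nat_of_bool; apply/idP/idP => [yk|/set_mem []].
  by apply: mem_set; split; rewrite /half/= ?lee_fin// leey.
by rewrite /half/= !lee_fin.
Qed.

End empirical_counts.

(** The deterministic half: one outcome is fixed, without ties and with the deviation rate. The
    error splits into the copula error amplified by N, the oscillation of the kernel over a cell,
    and the passage from (F_n, G_n) to (F, G), each at most e/4. *)
Lemma cb_kernel_consistent {R : realType} (A : R -> R -> R)
    (K : R -> {measure set R -> \bar R}) (X Y : nat -> R) (F G : R -> R) (s r : R) :
  is_markov_kernel A K -> continuous_kernel K -> 0 < s < r -> r < 2^-1 ->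
  (forall k l, k != l -> X k <> X l /\ Y k <> Y l) ->
  (forall x, 0 <= F x <= 1) -> (forall y, 0 <= G y <= 1) ->
  (\forall n \near \oo, forall x y,
    [/\ `|emp_joint_df X Y n x y - A (F x) (G y)| <= n%:R `^ (- r) + 4 / n%:R,
        `|emp_df X n x - F x| <= n%:R `^ (- r) + 4 / n%:R &
        `|emp_df Y n y - G y| <= n%:R `^ (- r) + 4 / n%:R]) ->
  (fun n => sup (range (fun p : R * R =>
     `| cb_kernel (Nres s n) (emp_copula X Y n) (emp_df X n p.1) (emp_df Y n p.2)
        - fine (K (F p.1) `[0, G p.2]%classic) |))) @ \oo --> (0 : R).
Proof.
move=> KA Kc /andP[s0 sr] r2 notie F01 G01 dev.
have [_ _ [mu [cA _]]] := KA.
apply: (@sup_cvg0 _ _ (0, 0)) => [n p|e e0]; first exact: normr_ge0.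
have cU : compact (@unitI R `*` @unitI R).
  by apply: compact_setX; exact: segment_compact.
have e4 : 0 < e / 4 by rewrite divr_gt0.
have [rho rho0 Krho] := compact_unif_continuous cU Kc e4.
have Kmod x x' y y' : 0 <= x <= 1 -> 0 <= x' <= 1 -> 0 <= y <= 1 -> 0 <= y' <= 1 ->
    `|x - x'| < rho -> `|y - y'| < rho ->
    `|fine (K x `[0, y]%classic) - fine (K x' `[0, y']%classic)| <= e / 4.
  move=> x1 x'1 y1 y'1 xx yy; apply/ltW.
  by apply: (Krho (x, y) (x', y')) => //; split; rewrite /unitI/= in_itv.
have r0 : 0 < r by lra.
have rs0 : 0 < r - s by lra.
near=> n => -[x y] /=.
have n1 : (0 < n)%N by near: n; exact: nbhs_infty_gt.
have n1' : 1 <= n%:R :> R by rewrite ler1n.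
have n0' : 0 < n%:R :> R by rewrite ltr0n.
have N0 : 0 < (Nres s n)%:R :> R by near: n; exact: Nres_lt_near.
have Nrho : rho^-1 < (Nres s n)%:R by near: n; exact: Nres_lt_near.
(* Since 1/n <= n^-r, the deviation n^-r + 4/n is at most 5 n^-r. *)
have nr : 5 / rho < n%:R `^ r by near: n; exact: near_powR_gt.
(* The copula error is at most (3 * 5 + 2) n^-r = 17 n^-r. Making 4 N 17 n^-r, at most 68 n^(s - r),
   smaller than e/4 asks for 272 = 4 * 68. *)
have nrs : 272 / e < n%:R `^ (r - s) by near: n; exact: near_powR_gt.
have devn : forall x y, [/\
        `|emp_joint_df X Y n x y - A (F x) (G y)| <= n%:R `^ (- r) + 4 / n%:R,
        `|emp_df X n x - F x| <= n%:R `^ (- r) + 4 / n%:R &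
        `|emp_df Y n y - G y| <= n%:R `^ (- r) + 4 / n%:R].
  by near: n.
set eps := n%:R `^ (- r) + 4 / n%:R in devn.
have ninv : n%:R^-1 <= n%:R `^ (- r).
  by rewrite -powR_inv1 ?ler0n//; apply: ler_powR => //; lra.
have eps5 : eps <= 5 * n%:R `^ (- r) by rewrite /eps; lra.
have epsrho : eps < rho.
  apply: (le_lt_trans eps5); rewrite powRN ltr_pdivrMr ?powR_gt0//.
  by rewrite mulrC -ltr_pdivrMr.
have NV : (Nres s n)%:R^-1 < rho.
  by rewrite -[rho]invrK ltf_pV2 ?posrE ?invr_gt0.
have inj (W : nat -> R) : (forall k l, k != l -> W k <> W l) ->
    forall k l, (k < n)%N -> (l < n)%N -> W k = W l -> k = l.
  by move=> h k l _ _ Wkl; apply: contrapT => /eqP /h.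
have EA := emp_copula_error cA n1
  (inj X (fun k l kl => (notie k l kl).1)) (inj Y (fun k l kl => (notie k l kl).2))
  F01 G01 (fun x => let: And3 _ h _ := devn x 0 in h)
  (fun y => let: And3 _ _ h := devn 0 y in h)
  (fun x y => let: And3 h _ _ := devn x y in h).
have K1 x1 x' y1 y' : 0 <= x1 <= 1 -> 0 <= x' <= 1 -> 0 <= y1 <= 1 -> 0 <= y' <= 1 ->
    `|x1 - x'| <= (Nres s n)%:R^-1 -> `|y1 - y'| <= (Nres s n)%:R^-1 ->
    `|fine (K x1 `[0, y1]%classic) - fine (K x' `[0, y']%classic)| <= e / 4.
  by move=> ? ? ? ? h h'; apply: Kmod => //; [exact: le_lt_trans h _|exact: le_lt_trans h' _].
have Nn0 : (0 < Nres s n)%N by rewrite -(ltr0n R).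
have main := cb_kernel_error KA Nn0 EA K1 (emp_df_01 X n x) (emp_df_01 Y n y).
have [_ dx dy] := devn x y.
have K2 : `|fine (K (emp_df X n x) `[0, emp_df Y n y]%classic)
    - fine (K (F x) `[0, G y]%classic)| <= e / 4.
  by apply: Kmod => //; rewrite ?emp_df_01//;
    [exact: le_lt_trans dx _|exact: le_lt_trans dy _].
have small : 4 * ((Nres s n)%:R * (3 * eps + 2 / n%:R)) <= e / 4.
  have d17 : 3 * eps + 2 / n%:R <= 17 * n%:R `^ (- r) by lra.
  have /andP[Ns _] := NresP s n.
  have h : (Nres s n)%:R * (3 * eps + 2 / n%:R) <= n%:R `^ s * (17 * n%:R `^ (- r)).
    apply: ler_pM => //.
    by rewrite addr_ge0 ?mulr_ge0 ?invr_ge0// addr_ge0 ?powR_ge0 ?mulr_ge0 ?invr_ge0.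
  have h2 : n%:R `^ s * (17 * n%:R `^ (- r)) = 17 / n%:R `^ (r - s).
    rewrite mulrCA; congr (17 * _); rewrite -powRN -powRD; last first.
      by apply/implyP => _; rewrite gt_eqF.
    by congr (_ `^ _); lra.
  have h3 : 17 / n%:R `^ (r - s) <= e / 16.
    rewrite ler_pdivrMr ?powR_gt0//.
    by move: nrs; rewrite ltr_pdivrMr//; lra.
  lra.
have := ler_distD (fine (K (emp_df X n x) `[0, emp_df Y n y]%classic))
  (cb_kernel (Nres s n) (emp_copula X Y n) (emp_df X n x) (emp_df Y n y))
  (fine (K (F x) `[0, G y]%classic)).
lra.
Unshelve. all: by end_near. Qed.

Theorem theorem3p1 (R : realType) (d : measure_display) (Omega : measurableType d)
  (P : probability Omega R) (X Y : nat -> Omega -> R)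
  (A : R -> R -> R) (K : R -> {measure set R -> \bar R}) (s : R) :
  iid_pairs P X Y ->
  (* H, the joint distribution function of (X,Y) = (X_1,Y_1), is continuous *)
  continuous (fun p : R * R => joint_df P (X 0%N) (Y 0%N) p.1 p.2) ->
  (* A is the copula of (X,Y) *)
  is_copula A ->
  (forall x y, joint_df P (X 0%N) (Y 0%N) x y
               = A (marg_df P (X 0%N) x) (marg_df P (Y 0%N) y)) ->
  (* K is the continuous version of the Markov kernel of A *)
  is_markov_kernel A K -> continuous_kernel K ->
  0 < s < 2^-1 ->
  {ae P, forall w,
    (fun n : nat =>
       sup (range (fun p : R * R =>
         `| cb_kernel (Nres s n) (emp_copula (X ^~ w) (Y ^~ w) n)
              (emp_df (X ^~ w) n p.1) (emp_df (Y ^~ w) n p.2)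
            - fine (K (marg_df P (X 0%N) p.1)
                      `[0, marg_df P (Y 0%N) p.2]%classic) |)))
    @ \oo --> (0 : R)}.
Proof.
move=> iid Hc _ HA KA Kc /andP[s0 s2].
have mX k : measurable_fun setT (X k) by case: iid.
have mY k : measurable_fun setT (Y k) by case: iid => _ [].
pose r := (s + 2^-1) / 2.
have r02 : 0 < r < 2^-1 by rewrite /r; lra.
have sr : 0 < s < r by rewrite /r; lra.
have ties : {ae P, forall w, forall k l, k != l -> X k w <> X l w /\ Y k w <> Y l w}.
  apply: ae_foralln => k; apply: ae_foralln => l.
  case: (eqVneq k l) => [->|kl]; first by apply: aeW.
  have [tX tY] := no_ties iid Hc kl.
  apply: (negligibleS _ (negligibleU tX tY)) => w /= nw.
  apply: contrapT => h; apply: nw => _; split => eq; apply: h; [by left|by right].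
apply: filterS2 ties (as_uniform_rate iid Hc r02) => w notie dev.
apply: (@cb_kernel_consistent _ A K (X ^~ w) (Y ^~ w) _ _ s r) => //.
- by case/andP: r02.
- by move=> x; exact: marg_df_01.
- by move=> y; exact: marg_df_01.
(* The three bounds are one deviation bound taken at (x, y), (x, +oo) and (+oo, y). *)
apply: filterS dev => n dev x y; split.
- rewrite emp_joint_df_count -HA -ext_joint_df_fin; exact: dev.
- rewrite (emp_df_fst_count X Y) -[marg_df P (X 0%N) x]/(ext_df (marg_df P (X 0%N)) x%:E).
  rewrite -(ext_joint_df_fst P (X 0%N) (Y 0%N)); exact: dev.
- rewrite (emp_df_snd_count X Y) -[marg_df P (Y 0%N) y]/(ext_df (marg_df P (Y 0%N)) y%:E).
  rewrite -(ext_joint_df_snd P (X 0%N) (Y 0%N)); exact: dev.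
Qed.
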